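(* Let $n\ge1$, let $r\ge n$, and let $T$ be a cube in $\mathbb{R}^n$. Then the canonical projections $\pi^k_{r-k}:C^\infty\Lambda^k(T)\to\mathcal{S}_{r-k}\Lambda^k(T)$, $0\le k\le n$, commute with the exterior derivative: for every $0\le k<n$ and every $\omega\in C^\infty\Lambda^k(T)$, $$d\,\pi^k_{r-k}\omega=\pi^{k+1}_{r-k-1}\,d\omega .$$ Moreover, $\pi^0_r c=c$ for every constant function $c\in\mathbb{R}$.
   Context: Polynomial forms. Let $\mathbb{N}_n=\{1,\dots,n\}$. For $\sigma=\{\sigma_1<\dots<\sigma_k\}\subset\mathbb{N}_n$ put $dx_\sigma=dx_{\sigma_1}\wedge\dots\wedge dx_{\sigma_k}$ and $\sigma^*=\mathbb{N}_n\setminus\sigma$. A $k$-form monomial is $m=x^\alpha\,dx_\sigma$ with $\alpha$ a multi-index and $\#\sigma=k$; set $\deg m=\sum_i\alpha_i$ and $\operatorname{ldeg} m=\#\{i\in\sigma^*: \alpha_i=1\}$. $\mathcal{P}_r\Lambda^k(\mathbb{R}^n)$ and $\mathcal{H}_r\Lambda^k(\mathbb{R}^n)$ are the spans of the $k$-form monomials of degree $\le r$, respectively $=r$. The linear degree $\operatorname{ldeg}$ of a polynomial form is the minimum of $\operatorname{ldeg} m$ over its monomials (the zero form counts as having linear degree at least $l$ for every $l$), and $\mathcal{H}_{r,l}\Lambda^k(\mathbb{R}^n)$ is the space of $\omega\in\mathcal{H}_r\Lambda^k(\mathbb{R}^n)$ with $\operatorname{ldeg}\omega\ge l$. Spaces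 of $k$-forms with $k>n$ or $k<0$, and $\mathcal P_s\Lambda^k$ with $s<0$, are zero. Koszul differential: $\kappa\bigl(\sum_\sigma\omega_\sigma\,dx_\sigma\bigr)=\sum_\sigma\omega_\sigma\sum_{i=1}^k(-1)^{i+1}x_{\sigma_i}\,dx_{\sigma_1}\wedge\dots\wedge\widehat{dx_{\sigma_i}}\wedge\dots\wedge dx_{\sigma_k}$ (zero on $0$-forms). $d$ is the exterior derivative. Shape functions: $\mathcal{J}_r\Lambda^k(\mathbb{R}^n)=\sum_{l\ge1}\kappa\,\mathcal{H}_{r+l-1,l}\Lambda^{k+1}(\mathbb{R}^n)$ and, for $r\ge 1$, $0\le k\le n$, $\mathcal{S}_r\Lambda^k(\mathbb{R}^n)=\mathcal{P}_r\Lambda^k(\mathbb{R}^n)+\mathcal{J}_r\Lambda^k(\mathbb{R}^n)+d\mathcal{J}_{r+1}\Lambda^{k-1}(\mathbb{R}^n)$. In particular $\mathcal{S}_r\Lambda^n=\mathcal{P}_r\Lambda^n$, and this is also used as the definition when $r=0$, $k=n$. $\mathcal{S}_r\Lambda^k(T)$ is the space of restrictions to $T$ of elements of $\mathcal{S}_r\Lambda^k(\mathbb{R}^n)$. Cubes and projections: ''cube'' means a cube with edges parallel to the coordinate axes (more generally, $T$ may be a Cartesian product of $n$ closed intervals of positive finite length). $\Delta_d(T)$ is the set of $d$-dimensional faces of $T$; $\operatorname{tr}_f\mu$ is the pullback of $\mu$ to $f$ under the inclusion; $\mathcal{P}_s\Lambda^j(f)$ is the space of polynomial $j$-forms on $f$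 with coefficients of degree at most $s$ in the free coordinates of $f$. The canonical projection $\pi_r^k$ sends a continuous $k$-form $\mu$ on $T$ to the element $\pi_r^k\mu\in\mathcal{S}_r\Lambda^k(T)$ uniquely determined by $$\int_f\operatorname{tr}_f(\pi_r^k\mu)\wedge\nu=\int_f\operatorname{tr}_f\mu\wedge\nu,\quad \nu\in\mathcal{P}_{r-2(d-k)}\Lambda^{d-k}(f),\ f\in\Delta_d(T),\ k\le d\le\min(n,\lfloor r/2\rfloor+k)$$ (existence and uniqueness of $\pi_r^k\mu$ being the unisolvence of these degrees of freedom; for $d=0$ the integral over a vertex is evaluation). $C^\infty\Lambda^k(T)$ is the space of smooth $k$-forms on $T$. *)

(* Defs.v *)
(* Library: Mathematical Components, MathComp-Analysis and multinomials. *)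
From HB Require Import structures.
From mathcomp Require Import all_boot all_order all_algebra.
(* The notations of mpoly are left out: they clash with MathComp-Analysis.
   [mpoly n R] is the type {mpoly R[n]}. *)
From mathcomp Require Import -(notations) mpoly.
From mathcomp Require Import all_classical all_reals all_analysis.

Set Implicit Arguments.
Unset Strict Implicit.
Unset Printing Implicit Defensive.

Import Order.TTheory GRing.Theory Num.Theory.
Import numFieldNormedType.Exports.

Local Open Scope classical_set_scope.
Local Open Scope ring_scope.

(* A form on R^n with coefficients in V is sum_s (w s) dx_s, s ranging over all
   subsets of the coordinates, which are numbered from 0; it is a k-form when
   only the s of cardinal k contribute. *)
Definition form (n : nat) (V : Type) := {ffun {set 'I_n} -> V}.

Definition is_kform n (V : nmodType) (k : nat) (w : form n V) : Prop :=
  forall s : {set 'I_n}, #|s| <> k -> w s = 0.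

(* Number of transpositions needed to sort dx_s /\ dx_t, for disjoint s, t:
   dx_s /\ dx_t = (-1) ^+ inversions s t dx_(s :|: t). *)
Definition inversions n (s t : {set 'I_n}) : nat :=
  #|[set p : 'I_n * 'I_n | [&& p.1 \in s, p.2 \in t & (p.2 < p.1)%N]]|.

Definition wedge n (V : pzRingType) (w v : form n V) : form n V :=
  [ffun s : {set 'I_n} => \sum_(t : {set 'I_n} | t \subset s)
     (-1) ^+ inversions t (s :\: t) * (w t * v (s :\: t))].

(* d w = sum_i dx_i /\ (partial_i w), for a given family D of partial
   derivatives; the coefficient of dx_s collects the i in s. *)
Definition ext_d n (V : pzRingType) (D : 'I_n -> V -> V) (w : form n V) :
    form n V :=
  [ffun s : {set 'I_n} => \sum_(i in s)
     (-1) ^+ inversions [set i] (s :\ i) * D i (w (s :\ i))].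

Definition const_form n (V : nmodType) (c : V) : form n V :=
  [ffun s : {set 'I_n} => if s == finset.set0 then c else 0].

Section PolynomialForms.
Variables (R : realType) (n : nat).

Definition pform := form n (mpoly n R).

Definition pform_d : pform -> pform := ext_d (@mderiv n R).

(* Koszul differential: dx_i is removed from dx_(i |: s), at the position given
   by the number of elements of s smaller than i. *)
Definition koszul (w : pform) : pform :=
  [ffun s : {set 'I_n} => \sum_(i | i \notin s)
     (-1) ^+ inversions [set i] s * (mpolyX R (mnm1 i) * w (i |: s)%SET)].

(* x^m dx_s is one of the monomials of w *)
Definition form_monomial (w : pform) (m : multinom n) (s : {set 'I_n}) : Prop :=
  m \in msupp (w s).

Definition ldeg (m : multinom n) (s : {set 'I_n}) : nat :=
  #|[set i : 'I_n | (i \notin s) && (m i == 1%N)]|.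

(* P_r Lambda^k *)
Definition PForm (r k : nat) : set pform :=
  [set w | is_kform k w /\
     forall m s, form_monomial w m s -> (mdeg m <= r)%N].

(* H_r Lambda^k *)
Definition HForm (r k : nat) : set pform :=
  [set w | is_kform k w /\
     forall m s, form_monomial w m s -> mdeg m = r].

(* H_{r,l} Lambda^k *)
Definition HlForm (r l k : nat) : set pform :=
  [set w | HForm r k w /\
     forall m s, form_monomial w m s -> (l <= ldeg m s)%N].

(* J_r Lambda^k: the index l >= 1 of the infinite sum of subspaces is l.+1
   here, so that r + l - 1 becomes r + l. *)
Definition JForm (r k : nat) : set pform :=
  [set w | exists (N : nat) (h : nat -> pform),
     (forall l, (l < N)%N -> HlForm (r + l) l.+1 k.+1 (h l)) /\
     w = \sum_(l < N) koszul (h l)].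

(* J_r Lambda^(k-1), which is 0 for k = 0 *)
Definition JForm_pred (r k : nat) : set pform :=
  if k is k'.+1 then JForm r k' else [set 0].

(* S_r Lambda^k. For r = 0 and k = n both J terms vanish, so this is P_0 Lambda^n. *)
Definition SForm (r k : nat) : set pform :=
  [set w | exists p j j' : pform,
     [/\ PForm r k p, JForm r k j, JForm_pred r.+1 k j' &
         w = p + j + pform_d j']].

(* P_s Lambda^j (f) for a face f whose free coordinates are those in F: neither
   the coefficients nor the dx_t involve the other coordinates. *)
Definition PFaceForm (F : {set 'I_n}) (s j : nat) : set pform :=
  [set v | [/\ PForm s j v,
     (forall t : {set 'I_n}, ~~ (t \subset F) -> v t = 0) &
     (forall m t, form_monomial v m t ->
        forall i : 'I_n, i \notin F -> m i = 0%N)]].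

End PolynomialForms.

Section FunctionForms.
Variables (R : realType) (n : nat).

Definition fform := form n ('rV[R]_n -> R).

Definition partial (i : 'I_n) (f : 'rV[R]_n -> R) : 'rV[R]_n -> R :=
  fun x => 'D_(delta_mx 0 i) f x.

Definition fform_d : fform -> fform := ext_d partial.

Definition eval_form (p : pform R n) : fform :=
  [ffun s : {set 'I_n} => fun x : 'rV[R]_n => meval (x 0) (p s)].

(* All iterated partial derivatives exist and are continuous on U. *)
Definition smooth_on (U : set 'rV[R]_n) (f : 'rV[R]_n -> R) : Prop :=
  forall (l : seq 'I_n) (x : 'rV[R]_n), U x ->
    {for x, continuous (foldr partial f l)} /\
    forall i : 'I_n, derivable (foldr partial f l) x (delta_mx 0 i).

Definition box (a b : 'rV[R]_n) : set 'rV[R]_n :=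
  [set x | forall i, a 0 i <= x 0 i <= b 0 i].

(* C^oo Lambda^k (T) for T = box a b: smooth k-forms on a neighbourhood of the
   closed set T. The partial derivatives at the points of T only depend on the
   restriction to T, as T is the closure of its interior when a i < b i. *)
Definition smooth_kform (a b : 'rV[R]_n) (k : nat) (w : fform) : Prop :=
  is_kform k w /\
  exists U : set 'rV[R]_n, [/\ open U, box a b `<=` U &
    forall s : {set 'I_n}, smooth_on U (w s)].

(* A face of box a b is given by the set F of its free coordinates, and by one
   of its vertices, [vertex a b e], which fixes the coordinates outside F. (Each
   face is obtained from several e.) *)
Definition vertex (a b : 'rV[R]_n) (e : {set 'I_n}) : 'rV[R]_n :=
  \row_i (if i \in e then b 0 i else a 0 i).

(* Pullback to a face with free coordinates F: the dx_i with i outside F vanish;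
   the coefficients are then only evaluated at points of the face. *)
Definition trace (F : {set 'I_n}) (w : fform) : fform :=
  [ffun s : {set 'I_n} => if s \subset F then w s else 0].

Definition set_coord (x : 'rV[R]_n) (i : 'I_n) (t : R) : 'rV[R]_n :=
  \row_j (if j == i then t else x 0 j).

(* Iterated integral over the coordinates in l, the others being those of x *)
Fixpoint iter_integral (a b : 'rV[R]_n) (l : seq 'I_n) (f : 'rV[R]_n -> R)
    (x : 'rV[R]_n) : R :=
  if l is i :: l' then
    (\int[lebesgue_measure]_(t in `[a 0 i, b 0 i])
       iter_integral a b l' f (set_coord x i t))%R
  else f x.

(* Integral of the #|F|-form w over the face oriented by dx_F; evaluation at
   the vertex if F is empty. *)
Definition face_integral (a b : 'rV[R]_n) (F e : {set 'I_n}) (w : fform) : R :=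
  iter_integral a b (enum F) (w F) (vertex a b e).

(* Here d = #|F|; the bound on d implies 2 (d - k) <= r. As T has non-empty
   interior when a i < b i, the restriction S_r Lambda^k (R^n) ->
   S_r Lambda^k (T) is bijective and the two spaces are identified. *)
Definition is_projection (r k : nat) (a b : 'rV[R]_n) (mu : fform)
    (p : pform R n) : Prop :=
  SForm r k p /\
  forall (F e : {set 'I_n}) (v : pform R n),
    (k <= #|F| <= minn n (r./2 + k))%N ->
    PFaceForm F (r - 2 * (#|F| - k)) (#|F| - k) v ->
    face_integral a b F e (wedge (trace F (eval_form p)) (eval_form v)) =
    face_integral a b F e (wedge (trace F mu) (eval_form v)).

(* The canonical projection pi_r^k: the p such that [is_projection r k a b mu p] *)
Definition projection (r k : nat) (a b : 'rV[R]_n) (mu : fform) : pform R n :=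
  xget 0 [set p | is_projection r k a b mu p].

End FunctionForms.

(* Main.v *)
(* Give both x_i and dx_i the weight e_i: kappa and d preserve the weight, and on
   the part of weight w = (w_i) a form has one coefficient for each set s of
   indices, so that kappa and d become the (weighted) boundary and coboundary of
   a simplex, with kappa d + d kappa = |w|. In these terms the part of weight w of
   S_r Lambda^k, when |w| > r + k, is kappa A + d kappa A, where A is spanned by the
   s which omit at least |w| - r - k of the i with w_i = 1. This description is stable under
   x_i := c, whatever the constant c.

   Uniqueness: let all degrees of freedom of u in S_r Lambda^k vanish. By induction
   on faces the traces of u on the facets of a face f vanish, so the terms of
   highest degree of tr_f u contain dx_i for every i with w_i = 1; the description
   above then excludes degrees larger than r. Hence the coefficient u_s may be
   tested against prod_i d_i^2 u_s (i free and outside s), and integration by parts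
   gives prod_i d_i u_s = 0, so u_s = 0.

   Existence: the degrees of freedom correspond to the k-form monomials m with
   deg m - ldeg m <= r, and a contracting homotopy of kappa maps the span of these
   monomials injectively into S_r Lambda^k; a square injective system is solvable.

   Commutation: by Stokes' theorem on each face, the degrees of freedom of d mu are
   combinations of those of mu, so d (pi mu) has the degrees of freedom of d mu. *)
Require Import Defs.
From HB Require Import structures.
From mathcomp Require Import all_boot all_order all_algebra.
From mathcomp Require Import -(notations) mpoly.
From mathcomp Require Import all_classical all_reals all_analysis.
From mathcomp Require Import ring lra zify.

Set Implicit Arguments.
Unset Strict Implicit.
Unset Printing Implicit Defensive.

Import Order.TTheory GRing.Theory Num.Theory.
Import numFieldNormedType.Exports.

Local Open Scope classical_set_scope.
Local Open Scope ring_scope.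

(** * Signs and cochains *)

(** Uniqueness descends to faces, so traces of shape functions must remain under control; the
    definition of S_r Lambda^k hides this, because x_i := c mixes the homogeneous pieces of the sum
    over l. [SwForm] is a class containing S_r Lambda^k and tested one weight at a time. The
    substitution adds up the weights w + j e_i with factors c ^+ j, so stability becomes a statement
    on cochains, [Sw_restr]. There kappa fails to commute with the restriction, but the defect omits
    more linear indices than required and is absorbed by the homotopy formula. A face F is kept
    inside R^n: its forms contain neither x_i nor dx_i for i outside F, so the induction never
    changes the dimension. Smooth forms are controlled only near T, while integrals depending on
    parameters are differentiated for functions continuous on R^n; the retraction [clamp] onto T
    reconciles the two. [projection] is a choice with default 0. Existence is established for the
    projection of omega; Stokes' theorem then exhibits that of d omega, also when r - k - 1 = 0. *)

Section Inversions.
Local Close Scope classical_set_scope.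
Local Open Scope set_scope.
Variable n : nat.
Implicit Types (i j : 'I_n) (s t u : {set 'I_n}).

(** The two sides differ by scope: the definition counts a classical set, whereas the right-hand
    side is a [{set _}], to which the finite set lemmas apply. *)
Lemma inversionsE s t : inversions s t =
  #|[set p : 'I_n * 'I_n | [&& p.1 \in s, p.2 \in t & (p.2 < p.1)%N]]|.
Proof.
apply: eq_card => p; apply/idP/idP => [/set_mem /= h|]; first by rewrite inE.
by rewrite inE => h; apply/mem_set.
Qed.

Lemma inversions1l i s : inversions [set i] s = #|[set j in s | (j < i)%N]|.
Proof.
rewrite inversionsE -(card_imset (f := fun j => (i, j)) _) /=; last by move=> x y [].
apply: eq_card => -[x y]; rewrite !inE /=.
apply/idP/imsetP => [/and3P[/eqP -> ys yi]|[z]]; first by exists y; rewrite ?inE ?ys.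
by rewrite inE => /andP[zs zi] [-> ->]; rewrite eqxx zs.
Qed.

Lemma inversionsUl s t u : [disjoint s & t] ->
  inversions (s :|: t) u = (inversions s u + inversions t u)%N.
Proof.
move=> dst; rewrite !inversionsE -[in RHS]cardsUI.
rewrite [X in (_ + X)%N](_ : _ = 0%N) ?addn0; last first.
  apply/eqP; rewrite cards_eq0; apply/eqP/setP=> -[x y]; rewrite !inE /=.
  have := disjointFr dst (x := x).
  by case: (x \in s) => //= ->; rewrite ?andbF.
apply: eq_card => -[x y]; rewrite !inE /=.
by case: (x \in s); case: (x \in t); case: (_ && _).
Qed.

Lemma inversionsUr s t u : [disjoint t & u] ->
  inversions s (t :|: u) = (inversions s t + inversions s u)%N.
Proof.
move=> dst; rewrite !inversionsE -[in RHS]cardsUI.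
rewrite [X in (_ + X)%N](_ : _ = 0%N) ?addn0; last first.
  apply/eqP; rewrite cards_eq0; apply/eqP/setP=> -[x y]; rewrite !inE /=.
  have := disjointFr dst (x := y); case: (y \in t) => //=; rewrite ?andbF // => -> //.
  by rewrite !andbF.
apply: eq_card => -[x y]; rewrite !inE /=.
by case: (y \in t); case: (y \in u); case: (x \in s); case: (_ < _)%N.
Qed.

Lemma inversions11 i j : inversions [set i] [set j] = (j < i)%N.
Proof.
rewrite inversions1l; case: (ltnP j i) => h.
  by rewrite (_ : [set _ in _ | _] = [set j]) ?cards1 //; apply/setP=> x; rewrite !inE;
     case: eqP => // ->; rewrite h.
by apply/eqP; rewrite cards_eq0; apply/eqP/setP=> x; rewrite !inE; case: eqP => // ->;
   rewrite ltnNge h.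
Qed.

Lemma inversions1C i s : i \notin s ->
  (inversions [set i] s + inversions s [set i])%N = #|s|.
Proof.
have [m] := ubnP #|s|; elim: m s => // m IH s sm iNs.
have [->|[j js]] := set_0Vmem s.
  rewrite cards0 !inversionsE.
  by rewrite !eq_card0 // => -[x y]; rewrite !inE ?andbF.
have [ij iNsj] : i != j /\ i \notin s :\ j.
  by split; [apply: contraNneq iNs => -> | rewrite !inE negb_and iNs orbT].
rewrite -(finset.setD1K js).
have dj : [disjoint [set j] & s :\ j] by rewrite disjoints1 !inE eqxx.
rewrite inversionsUl // inversionsUr // !inversions11 cardsU1 !inE eqxx /=.
have sm' : (#|s :\ j| < m)%N by move: sm; rewrite (cardsD1 j s) js.
rewrite -(IH _ sm' iNsj).
by move: ij; rewrite -val_eqE /=; case: ltngtP; lia.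
Qed.
End Inversions.

(** * Exterior and interior multiplication on cochains of a simplex *)

Section Cochains.
Local Close Scope classical_set_scope.
Local Open Scope set_scope.
Variables (R : realType) (n : nat).
Implicit Types (i j : 'I_n) (s t u : {set 'I_n}) (C h g : {set 'I_n} -> R).
Implicit Types (w : 'I_n -> nat).

Definition sgn s t : R := (-1) ^+ inversions s t.

Lemma sgn_sqr s t : sgn s t * sgn s t = 1.
Proof. by rewrite /sgn -expr2 sqrr_sign. Qed.

Lemma sgnUl s t u : [disjoint s & t] -> sgn (s :|: t) u = sgn s u * sgn t u.
Proof. by move=> st; rewrite /sgn inversionsUl // exprD. Qed.

Lemma sgnUr s t u : [disjoint t & u] -> sgn s (t :|: u) = sgn s t * sgn s u.
Proof. by move=> st; rewrite /sgn inversionsUr // exprD. Qed.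

Lemma sgn1C i s : i \notin s -> sgn [set i] s * sgn s [set i] = (-1) ^+ #|s|.
Proof. by move=> /inversions1C <-; rewrite /sgn exprD. Qed.

Lemma sgn11 i j : i != j -> sgn [set i] [set j] = - sgn [set j] [set i].
Proof.
rewrite /sgn !inversions11 -val_eqE /=; case: ltngtP => // _ _.
by rewrite expr0 expr1 opprK.
Qed.

(** Exterior and interior multiplication by the i-th basis vector. Their anticommutation relations
    ([int_ext_i], [ext_extC], [int_intC]) yield all the identities between [Kz] and [Dx]. *)
Definition ext_i i C s : R :=
  if i \in s then sgn [set i] (s :\ i) * C (s :\ i) else 0.
Definition int_i i C s : R :=
  if i \notin s then sgn [set i] s * C (i |: s) else 0.

Lemma setU1D1 i j s : i != j -> (i |: s) :\ j = i |: (s :\ j).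
Proof.
move=> ij; apply/setP=> x; rewrite !inE; case: (eqVneq x i) => //= ->.
by rewrite ij.
Qed.

Lemma sgn1U1 i j s : j \notin s ->
  sgn [set i] (j |: s) = sgn [set i] [set j] * sgn [set i] s.
Proof. by move=> js; rewrite sgnUr // disjoints1. Qed.

Lemma int_ext_i i j C s :
  int_i i (ext_i j C) s = (i == j)%:R * C s - ext_i j (int_i i C) s.
Proof.
rewrite /int_i /ext_i; case: (eqVneq i j) => [<-|ij].
  rewrite setD11 setU11 mul1r /=; case: (boolP (i \in s)) => is_ /=.
    by rewrite mulrA sgn_sqr mul1r finset.setD1K // subrr.
  by rewrite setU1K // mulrA sgn_sqr mul1r subr0.
rewrite !inE (negPf ij) /= mul0r sub0r eq_sym (negPf ij) /=.
case: (boolP (j \in s)) => js; last by case: (i \in s); rewrite ?mulr0 oppr0.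
case: (boolP (i \in s)) => is_; rewrite /= ?mulr0 ?oppr0 //.
rewrite setU1D1 // !mulrA -mulNr; congr (_ * _).
rewrite -{1}(finset.setD1K js) !sgn1U1 ?inE ?eqxx ?(negPf is_) ?andbF //.
by rewrite (sgn11 ij); ring: (sgn_sqr [set j] [set i]).
Qed.

Lemma ext_extC i j C s : ext_i i (ext_i j C) s = - ext_i j (ext_i i C) s.
Proof.
rewrite /ext_i; case: (eqVneq i j) => [<-|ij].
  by rewrite setD11 mulr0; case: (i \in s); rewrite oppr0.
rewrite !inE (negPf ij) (eq_sym j i) (negPf ij) /=.
case: (boolP (i \in s)) => is_; case: (boolP (j \in s)) => js;
  rewrite ?mulr0 ?oppr0 //.
have ji : j \in s :\ i by rewrite !inE eq_sym ij.
have ij' : i \in s :\ j by rewrite !inE ij.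
have E : s :\ i :\ j = s :\ j :\ i by apply/setP=> x; rewrite !inE andbCA.
rewrite -[in X in X * _](finset.setD1K ji) -[in X in - (X * _)](finset.setD1K ij') E.
rewrite !sgn1U1 ?inE ?eqxx ?andbF //.
by rewrite (sgn11 ij); ring.
Qed.

Lemma int_intC i j C s : int_i i (int_i j C) s = - int_i j (int_i i C) s.
Proof.
rewrite /int_i !inE !negb_or; case: (eqVneq i j) => [<-|ij].
  by rewrite /= mulr0; case: (i \in s); rewrite oppr0.
rewrite /=.
case: (boolP (i \in s)) => is_; case: (boolP (j \in s)) => js;
  rewrite /= ?mulr0 ?oppr0 //.
by rewrite !sgn1U1 // (sgn11 ij) finset.setUCA; ring.
Qed.

(* The Koszul and exterior differentials act in this way on the coefficients of
   a form of weight w, see [wcomp] below. *)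
Definition Kz C s : R := \sum_i int_i i C s.
Definition Dx w C s : R := \sum_i (w i)%:R * ext_i i C s.

Lemma ext_i_lin i a b C h s :
  ext_i i (fun t => a * C t + b * h t) s = a * ext_i i C s + b * ext_i i h s.
Proof. by rewrite /ext_i; case: ifP => _; ring. Qed.

Lemma int_i_lin i a b C h s :
  int_i i (fun t => a * C t + b * h t) s = a * int_i i C s + b * int_i i h s.
Proof. by rewrite /int_i; case: ifP => _; ring. Qed.

Lemma Kz_lin a b C h s :
  Kz (fun t => a * C t + b * h t) s = a * Kz C s + b * Kz h s.
Proof.
by rewrite /Kz 2!big_distrr -big_split; apply: eq_bigr => i _; rewrite int_i_lin.
Qed.

Lemma Dx_lin w a b C h s :
  Dx w (fun t => a * C t + b * h t) s = a * Dx w C s + b * Dx w h s.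
Proof.
rewrite /Dx 2!big_distrr -big_split; apply: eq_bigr => i _; rewrite ext_i_lin /=.
by ring.
Qed.

Lemma Kz_sum (I : finType) (c : I -> R) (G : I -> {set 'I_n} -> R) s :
  Kz (fun t => \sum_j c j * G j t) s = \sum_j c j * Kz (G j) s.
Proof.
rewrite /Kz; under [RHS]eq_bigr do rewrite big_distrr.
rewrite exchange_big; apply: eq_bigr => i _; rewrite /int_i; case: ifP => _.
  by rewrite big_distrr; apply: eq_bigr => j _ /=; ring.
by rewrite big1 // => j _; rewrite /= mulr0.
Qed.

Lemma ext_i_sum (I : finType) i (c : I -> R) (G : I -> {set 'I_n} -> R) s :
  ext_i i (fun t => \sum_j c j * G j t) s = \sum_j c j * ext_i i (G j) s.
Proof.
rewrite /ext_i; case: ifP => _; last by rewrite big1 // => j _; rewrite /= mulr0.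
by rewrite big_distrr; apply: eq_bigr => j _ /=; ring.
Qed.

Lemma int_i_sum (I : finType) i (c : I -> R) (G : I -> {set 'I_n} -> R) s :
  int_i i (fun t => \sum_j c j * G j t) s = \sum_j c j * int_i i (G j) s.
Proof.
rewrite /int_i; case: ifP => _; last by rewrite big1 // => j _; rewrite /= mulr0.
by rewrite big_distrr; apply: eq_bigr => j _ /=; ring.
Qed.

Lemma Dx_sum w (I : finType) (c : I -> R) (G : I -> {set 'I_n} -> R) s :
  Dx w (fun t => \sum_j c j * G j t) s = \sum_j c j * Dx w (G j) s.
Proof.
rewrite /Dx; under [RHS]eq_bigr do rewrite big_distrr.
rewrite exchange_big; apply: eq_bigr => i _; rewrite ext_i_sum big_distrr.
by apply: eq_bigr => j _ /=; ring.
Qed.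

Lemma eq_Kz C h : C =1 h -> Kz C =1 Kz h.
Proof. by move=> /funext ->. Qed.
Lemma eq_Dx w C h : C =1 h -> Dx w C =1 Dx w h.
Proof. by move=> /funext ->. Qed.

Lemma Kz_ext_i i C s : Kz (ext_i i C) s = C s - ext_i i (Kz C) s.
Proof.
rewrite /Kz (eq_bigr _ (fun j _ => int_ext_i j i C s)) sumrB; congr (_ - _).
  rewrite (bigD1 i) //= eqxx mul1r big1 ?addr0 // => j /negPf ->.
  by rewrite mul0r.
under eq_bigr do rewrite -[ext_i _ _ _]mul1r; rewrite -ext_i_sum.
by congr ext_i; apply/funext => t; apply: eq_bigr => j _; rewrite mul1r.
Qed.

Lemma KzDx w C s : Kz (Dx w C) s = (\sum_i w i)%:R * C s - Dx w (Kz C) s.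
Proof.
rewrite [Dx w C]/Dx Kz_sum natr_sum mulr_suml -sumrB.
by apply: eq_bigr => i _; rewrite Kz_ext_i; ring.
Qed.

Lemma antisym_sum0 (G : 'I_n -> 'I_n -> R) :
  (forall i j, G i j = - G j i) -> \sum_i \sum_j G i j = 0.
Proof.
move=> GC; suff : \sum_i \sum_j G i j = - \sum_i \sum_j G i j by lra.
rewrite {1}exchange_big -sumrN; apply: eq_bigr => i _.
by rewrite -sumrN; apply: eq_bigr => j _; rewrite GC.
Qed.

Lemma KzKz C s : Kz (Kz C) s = 0.
Proof.
rewrite -[RHS](@antisym_sum0 (fun i j => int_i i (int_i j C) s)); last first.
  by move=> i j; exact: int_intC.
rewrite {1}/Kz; apply: eq_bigr => i _; rewrite {1}/Kz.
under [RHS]eq_bigr do rewrite -[int_i _ _ _]mul1r; rewrite -int_i_sum.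
by congr int_i; apply/funext => t; apply: eq_bigr => j _; rewrite mul1r.
Qed.

Lemma DxDx w C s : Dx w (Dx w C) s = 0.
Proof.
rewrite -[RHS](@antisym_sum0
   (fun i j => (w i * w j)%:R * ext_i i (ext_i j C) s)); last first.
  by move=> i j; rewrite ext_extC mulnC mulrN.
rewrite {1}/Dx; apply: eq_bigr => i _; rewrite [Dx w C]/Dx ext_i_sum big_distrr.
by apply: eq_bigr => j _; rewrite /= natrM mulrA.
Qed.

Lemma Kz0 s : Kz (fun=> 0) s = 0.
Proof. by rewrite /Kz big1 // => i _; rewrite /int_i mulr0 if_same. Qed.
Lemma Dx0 w s : Dx w (fun=> 0) s = 0.
Proof. by rewrite /Dx big1 // => i _; rewrite /ext_i mulr0 if_same mulr0. Qed.

End Cochains.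

(** * Cochains filtered by linear degree, and their restrictions to x_i := c *)

Section Chains.
Local Close Scope classical_set_scope.
Local Open Scope set_scope.
Variables (R : realType) (n : nat).
Implicit Types (i j : 'I_n) (s t u : {set 'I_n}) (C h g : {set 'I_n} -> R).
Implicit Types (w : 'I_n -> nat) (k l r : nat).

Definition wsupp w : {set 'I_n} := [set i | w i != 0%N].
Definition wlin w : {set 'I_n} := [set i | w i == 1%N].
Definition wdeg w : nat := \sum_i w i.

(** [#|wlin w :\: s|] is the linear degree of the monomial of weight [w] that contains [dx_s], so
    this describes the k-forms of weight [w] and of linear degree at least [l]. *)
Definition chain w l k C : Prop := forall s, C s != 0 ->
  [/\ #|s| = k, s \subset wsupp w & (l <= #|wlin w :\: s|)%N].

Lemma chainW w l l' k C : (l' <= l)%N -> chain w l k C -> chain w l' k C.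
Proof. by move=> ll cC s /cC[? ? ?]; split=> //; exact: leq_trans ll _. Qed.

Lemma chain_lin w l k a b C h : chain w l k C -> chain w l k h ->
  chain w l k (fun s => a * C s + b * h s).
Proof.
move=> cC ch s; have [/eqP C0|/cC//] := boolP (C s == 0).
have [/eqP h0|/ch//] := boolP (h s == 0).
by rewrite C0 h0 !mulr0 addr0 eqxx.
Qed.

Lemma chainZ w l k a C : chain w l k C -> chain w l k (fun s => a * C s).
Proof.
move=> cC s; have [/eqP C0|/cC//] := boolP (C s == 0).
by rewrite C0 mulr0 eqxx.
Qed.

Lemma chain0 w l k : chain w l k (fun=> 0).
Proof. by move=> s; rewrite eqxx. Qed.

Lemma chain_eq w l k C h : C =1 h -> chain w l k C -> chain w l k h.
Proof. by move=> /funext ->. Qed.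

Lemma Dx_neq0 w C s : Dx w C s != 0 ->
  exists2 i, i \in s & (w i != 0%N) && (C (s :\ i) != 0).
Proof.
move=> Ds; apply/exists_inP; apply: contraNT Ds; rewrite negb_exists_in.
move=> /forall_inP H; rewrite /Dx big1 // => i _; rewrite /ext_i.
case: ifP => [/H|_]; last by rewrite mulr0.
rewrite negb_and !negbK => /orP[] /eqP ->; first by rewrite mul0r.
by rewrite !mulr0.
Qed.

Lemma KzZ a C s : Kz (fun t => a * C t) s = a * Kz C s.
Proof.
rewrite -[RHS]addr0 -[X in _ + X](mul0r (Kz C s)) -Kz_lin; apply: eq_Kz => t.
by rewrite mul0r addr0.
Qed.

Lemma KzD C h s : Kz (fun t => C t + h t) s = Kz C s + Kz h s.
Proof.
rewrite -[Kz C s]mul1r -[Kz h s]mul1r -Kz_lin; apply: eq_Kz => t.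
by rewrite !mul1r.
Qed.

Lemma DxZ w a C s : Dx w (fun t => a * C t) s = a * Dx w C s.
Proof.
rewrite -[RHS]addr0 -[X in _ + X](mul0r (Dx w C s)) -Dx_lin; apply: eq_Dx => t.
by rewrite mul0r addr0.
Qed.

Lemma DxD w C h s : Dx w (fun t => C t + h t) s = Dx w C s + Dx w h s.
Proof.
rewrite -[Dx w C s]mul1r -[Dx w h s]mul1r -Dx_lin; apply: eq_Dx => t.
by rewrite !mul1r.
Qed.

(** Adjoining one index to a set uses up at most one of the linear indices that the set omits. *)
Lemma chain_Dx w l k C : chain w l k C -> chain w l.-1 k.+1 (Dx w C).
Proof.
move=> cC s /Dx_neq0[i is_ /andP[wi0 /cC[sk ss sl]]]; split.
- by rewrite (cardsD1 i s) is_ sk.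
- by rewrite -(finset.setD1K is_) finset.subUset ss andbT finset.sub1set inE.
- have : (#|wlin w :\: (s :\ i)| <= #|[set i]| + #|wlin w :\: s|)%N.
    apply: leq_trans (leq_card_setU _ _); apply: subset_leq_card.
    by apply/fintype.subsetP => x; rewrite !inE; case: (x == i).
  by rewrite cards1; move: sl; lia.
Qed.

Definition restr i C s : R := if i \in s then 0 else C s.

Lemma restr_Dx i w w' C : (forall j, j != i -> w j = w' j) -> w' i = 0%N ->
  restr i (Dx w C) =1 Dx w' (restr i C).
Proof.
move=> ww w'i s; rewrite /restr; case: ifP => is_.
  rewrite /Dx big1 // => j _; rewrite /ext_i; case: ifP => [js|]; last by rewrite mulr0.
  rewrite !inE is_ andbT; case: eqVneq => [ij|]; last by rewrite !mulr0.
  by rewrite -ij w'i mul0r.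
rewrite /Dx; apply: eq_bigr => j _; rewrite /ext_i; case: ifP => js; last by rewrite !mulr0.
by rewrite !inE is_ andbF ww //; apply: contraFneq is_ => <-.
Qed.

(** Contracting [i] takes a set containing [i], which the restriction kills, to one that survives:
    hence the defect [int_i i h], which has no counterpart in [restr_Dx]. *)
Lemma restr_Kz i h s : restr i (Kz h) s = Kz (restr i h) s + int_i i h s.
Proof.
rewrite /Kz [in LHS]/restr; case: ifP => is_.
  rewrite {2}/int_i is_ addr0 big1 // => j _; rewrite /int_i /restr.
  by rewrite !inE is_ orbT mulr0 if_same.
rewrite [in LHS](bigD1 i) //= [in RHS](bigD1 i) //= [X in _ = X + _ + _](_ : _ = 0).
  rewrite add0r addrC; congr (_ + _); apply: eq_bigr => j ji; rewrite /int_i /restr.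
  by rewrite !inE is_ eq_sym (negPf ji).
by rewrite /int_i /restr !inE eqxx mulr0 if_same.
Qed.

(** A set that avoids [i] counts [i] among its omitted linear indices exactly when [w i = 1], and
    this is the only one that disappears in [w']. *)
Lemma chain_restr i w w' l l' k C : (forall j, j != i -> w j = w' j) ->
  w' i = 0%N -> (l' + (w i == 1) <= l)%N ->
  chain w l k C -> chain w' l' k (restr i C).
Proof.
move=> ww w'i ll cC s; rewrite /restr; case: ifP => is_; first by rewrite eqxx.
move=> /cC[sk ss sl]; split=> //.
  apply/fintype.subsetP => x xs; move/fintype.subsetP: ss => /(_ x xs); rewrite !inE ww //.
  by apply: contraFneq is_ => <-.
suff : (#|wlin w :\: s| <= (w i == 1) + #|wlin w' :\: s|)%N by lia.
case: (boolP (w i == 1%N)) => wi.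
  have -> : true = #|[set i]| :> nat by rewrite cards1.
  apply: leq_trans (leq_card_setU _ _); apply: subset_leq_card.
  apply/fintype.subsetP => x; rewrite !inE; case: (eqVneq x i) => //= xi.
  by rewrite ww.
apply: subset_leq_card.
apply/fintype.subsetP => x; rewrite !inE; case: (eqVneq x i) => [->|xi]; last by rewrite ww.
by rewrite (negPf wi) andbF.
Qed.

Lemma chain_int_i i w w' l k C : (forall j, j != i -> w j = w' j) ->
  chain w l k.+1 C -> chain w' l k (int_i i C).
Proof.
move=> ww cC s; rewrite /int_i; case: ifP => is_; last by rewrite eqxx.
rewrite mulf_eq0 negb_or => /andP[_ /cC[]]; rewrite cardsU1 is_ add1n => -[sk] ss sl.
split=> //.
  apply/fintype.subsetP => x xs; move/fintype.subsetP: ss => /(_ x).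
  by rewrite !inE xs orbT ww; [exact|apply: contraNneq is_ => <-].
apply: leq_trans sl _; apply: subset_leq_card.
apply/fintype.subsetP => x; rewrite !inE negb_or -andbA => /and3P[xi -> /=].
by rewrite ww.
Qed.

(* The condition satisfied by the part of weight w of the forms in S_r Lambda^k *)
Definition Sw r k w C : Prop := (wdeg w <= r + k)%N \/
  exists h h', [/\ chain w (wdeg w - (r + k)) k.+1 h, chain w (wdeg w - (r + k)) k h'
    & C =1 (fun s => Kz h s + Dx w (Kz h') s)].

Lemma Sw_lin r k w a b C h : Sw r k w C -> Sw r k w h ->
  Sw r k w (fun s => a * C s + b * h s).
Proof.
move=> [|[C1 [C2 [c1 c2 eC]]]]; first by left.
move=> [|[h1 [h2 [d1 d2 eh]]]]; first by left.
right; exists (fun s => a * C1 s + b * h1 s), (fun s => a * C2 s + b * h2 s); split.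
- exact: chain_lin.
- exact: chain_lin.
- move=> s; rewrite eC eh Kz_lin (eq_Dx _ (Kz_lin _ _ _ _)) Dx_lin; ring.
Qed.

(* A chain of too high a level is homotopic to zero within its level, up to the
   factor [wdeg w]. *)
Lemma Sw_chain r k w g : chain w (wdeg w - (r + k)).+1 k g -> Sw r k w g.
Proof.
move=> cg; case: (leqP (wdeg w) (r + k)) => wr; [by left | right].
have w0 : (wdeg w)%:R != 0 :> R by rewrite pnatr_eq0; lia.
exists (fun s => (wdeg w)%:R^-1 * Dx w g s), (fun s => (wdeg w)%:R^-1 * g s); split.
- exact/chainZ/(chain_Dx cg).
- by apply/chainZ/(chainW _ cg).
- move=> s; rewrite KzZ KzDx -/(wdeg w) (eq_Dx _ (KzZ _ g)) DxZ.
  by field.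
Qed.

(** From K D + D K = |w| and D D = 0 follows D K D g = |w| D g, so D g is D K applied to D g / |w|,
    whose level is one below that of [g]. *)
Lemma Sw_Dx r k w g : (0 < wdeg w)%N -> chain w (wdeg w - (r + k.+1)).+1 k g -> Sw r k.+1 w (Dx w g).
Proof.
move=> w_gt0 cg; case: (leqP (wdeg w) (r + k.+1)) => wr; [by left | right].
have w0 : (wdeg w)%:R != 0 :> R by rewrite pnatr_eq0; lia.
exists (fun=> 0), (fun s => (wdeg w)%:R^-1 * Dx w g s); split.
- exact: chain0.
- exact/chainZ/(chain_Dx cg).
- move=> s; rewrite Kz0 add0r (eq_Dx _ (KzZ _ _)) DxZ (eq_Dx _ (KzDx w g)).
  rewrite -/(wdeg w) DxD DxZ (eq_Dx _ (fun t => esym (mulN1r _))) DxZ DxDx.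
  by field.
Qed.

Lemma Sw_eq r k w C h : C =1 h -> Sw r k w C -> Sw r k w h.
Proof. by move=> /funext ->. Qed.

(** Restricting K h + D K h' gives K and D K of the restrictions of [h] and [h'], plus the defects
    int_i h and D (int_i h') of [restr_Kz]. Passing from [w] to [w'] lowers the required level by
    [w i], which pays for the possible loss of [i] in the first two terms. The defects have a level
    to spare, so [Sw_chain] and [Sw_Dx] apply to them. *)
Lemma Sw_restr i r k w w' C : (forall j, j != i -> w j = w' j) -> w' i = 0%N ->
  Sw r k w C -> Sw r k w' (restr i C).
Proof.
move=> ww w'i; have wdegE : wdeg w = (w i + wdeg w')%N.
  rewrite /wdeg (bigD1 i) //= [in RHS](bigD1 i) //= w'i add0n; congr addn.
  by apply: eq_bigr => j /ww.
case: (leqP (wdeg w') (r + k)) => [|wr]; first by left.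
move=> [|[h [h' [ch ch' eC]]]]; first by lia.
pose l := (wdeg w - (r + k))%N; pose l' := (wdeg w' - (r + k))%N.
have ll : (l' + (w i == 1) <= l)%N by rewrite /l /l' wdegE; case: (w i) => [|[|?]] //=; lia.
(* Only sets containing [i] matter, so no omitted linear index is lost, while the required level
   drops by [w i]; if [w i = 0] there are no such sets. *)
have cint m G : chain w l m.+1 G -> chain w' l'.+1 m (int_i i G).
  have [wi0|wi0] := eqVneq (w i) 0%N.
    move=> cG s; rewrite /int_i; case: ifP => is_; last by rewrite eqxx.
    rewrite mulf_eq0 negb_or => /andP[_ /cG[_ /fintype.subsetP/(_ i)]].
    by rewrite !inE eqxx wi0 => /(_ isT).
  move=> cG; apply: (chainW (l := l)); first by rewrite /l /l' wdegE; lia.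
  exact: chain_int_i cG.
apply: (Sw_eq (C := fun s => 1 * (1 * int_i i h s + 1 * (Kz (restr i h) s + Dx w' (Kz (restr i h')) s)) + 1 * Dx w' (int_i i h') s)).
  move=> s; rewrite (_ : restr i C s = restr i (Kz h) s + restr i (Dx w (Kz h')) s).
    rewrite restr_Kz (restr_Dx _ ww w'i) (eq_Dx _ (restr_Kz i h')) DxD; ring.
  by rewrite /restr; case: ifP; rewrite ?addr0.
apply: Sw_lin; first apply: Sw_lin.
- exact/Sw_chain/cint.
- right; exists (restr i h), (restr i h'); split=> //.
  + exact: chain_restr ch.
  + exact: chain_restr ch'.
(* For k = 0 the chain [h'] lives on the empty set, so its contraction vanishes. *)
- case: k ch' {ch eC h} wr @l @l' ll cint => [|k] ch' wr l l' ll cint.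
    apply: (Sw_eq (C := fun=> 0)); last by apply: Sw_chain; exact: chain0.
    move=> s; rewrite -[LHS](Dx0 R w' s); apply: eq_Dx => t; rewrite /int_i; case: ifP => // it.
    have [/eqP->|/ch'[]] := boolP (h' (i |: t) == 0); first by rewrite mulr0.
    by rewrite cardsU1 it.
  by apply: Sw_Dx; [lia | exact: cint].
Qed.

(* The monomials of highest degree of a form whose traces vanish contain [dx_i]
   for every linear variable [x_i], hence this lemma kills them. *)
Lemma Sw_top r k w C : (r + k < wdeg w)%N -> Sw r k w C ->
  (forall s, C s != 0 -> [/\ #|s| = k, s \subset wsupp w & wlin w \subset s]) ->
  forall s, C s = 0.
Proof.
move=> wr [|[h [h' [ch ch' eC]]]]; first by lia.
move=> cC s; apply/eqP/negPn/negP => Cs0.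
have [sk ss ls] := cC _ Cs0.
set l := (_ - _)%N in ch ch'; have l_gt0 : (0 < l)%N by rewrite /l; lia.
have Kz_lin0 m G t : chain w l m G -> wlin w \subset t -> Kz G t = 0.
  move=> cG lt; rewrite /Kz big1 // => i _; rewrite /int_i; case: ifP => // it.
  have [/eqP->|/cG[_ _]] := boolP (G (i |: t) == 0); first by rewrite mulr0.
  rewrite (_ : _ :\: _ = finset.set0) ?cards0; first by lia.
  apply/eqP; rewrite finset.setD_eq0; apply: fintype.subset_trans lt _; exact: finset.subsetUr.
have KC t : Kz C t = (wdeg w)%:R * Kz h' t.
  rewrite (eq_Kz eC).
  have := Kz_lin 1 1 (Kz h) (Dx w (Kz h')) t; rewrite !mul1r KzKz add0r KzDx -/(wdeg w).
  rewrite (eq_Dx _ (KzKz h')) Dx0 subr0 => <-.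
  by apply: eq_Kz => u; rewrite !mul1r.
(* Since [s] contains all linear indices, only D (K h') contributes to [C s], and |w| K h' = K C. An
   i with w_i > 1 gives 0, as [s :\ i] still contains every linear index. A linear i gives back
   [C s], because among the sets [j |: s :\ i] only [s] itself contains i. *)
have : (wdeg w)%:R * C s = #|wlin w|%:R * C s.
  rewrite {1}eC (Kz_lin0 _ _ _ ch ls) add0r /Dx big_distrr /=.
  rewrite (bigID (mem (wlin w))) /= [X in _ + X]big1 ?addr0.
    rewrite -sum1_card natr_sum mulr_suml; apply: eq_bigr => i il.
    move: (il); rewrite inE => /eqP ->; have is_ := fintype.subsetP ls _ il.
    rewrite /ext_i is_ mul1r mulrCA -KC mul1r.
    rewrite /Kz (bigD1 i) //= {1}/int_i !inE eqxx /= finset.setD1K // big1.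
      by rewrite addr0 mulrA sgn_sqr mul1r.
    move=> j ji; rewrite /int_i; case: ifP => // _.
    have [/eqP->|/cC[_ _]] := boolP (C (j |: s :\ i) == 0); first by rewrite mulr0.
    by move=> /fintype.subsetP/(_ i il); rewrite !inE eqxx eq_sym (negPf ji).
  move=> i il; rewrite /ext_i; case: ifP => is_; rewrite ?mulr0 //.
  rewrite (Kz_lin0 _ _ _ ch') ?mulr0 //.
  by rewrite subsetD1 ls il.
move/(mulIf Cs0)/eqP; rewrite eqr_nat => /eqP wE.
(* |w| equals the number of linear indices, which leaves no room for another index in the support.
   Hence [s = wlin w] and |w| = k, against r + k < |w|. *)
have w1 i : i \in wsupp w -> i \in wlin w.
  move=> iw; apply: contraT => il.
  have : (\sum_(j in wlin w) w j + w i <= wdeg w)%N.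
    rewrite /wdeg [leqRHS](bigD1 i) //= addnC leq_add2l.
    rewrite [leqRHS](bigID (mem (wlin w))) /=; apply: leq_trans (leq_addr _ _).
    rewrite [leqRHS](eq_bigl (mem (wlin w))) // => j /=.
    by case: (eqVneq j i) => //= ->; rewrite (negPf il).
  rewrite (eq_bigr (fun=> 1%N)); last by move=> j; rewrite inE => /eqP.
  by rewrite sum1_card wE; move: iw; rewrite inE; lia.
have : s = wlin w.
  apply/eqP; rewrite finset.eqEsubset ls andbT; apply/fintype.subsetP => x xs.
  by apply: w1; exact: fintype.subsetP ss _ xs.
by move=> sE; move: wr; rewrite wE -sE sk; lia.
Qed.
End Chains.

(** * Weights of polynomial forms *)

Section Weights.
Local Close Scope classical_set_scope.
Local Open Scope set_scope.
Variables (R : realType) (n : nat).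
Implicit Types (i j : 'I_n) (s t F : {set 'I_n}) (w m : multinom n).
Implicit Types (p q : mpoly n R) (om : pform R n).

Definition weight m s : multinom n := mnm_add m (mesym1 s).

Lemma weightE m s i : weight m s i = (m i + (i \in s))%N.
Proof. by rewrite /weight mnmDE mnmE. Qed.

Lemma weightK m s : mnm_sub (weight m s) (mesym1 s) = m.
Proof. by apply/mnmP => i; rewrite mnmBE weightE mnmE addnK. Qed.

Lemma weight_sub w s : s \subset wsupp w -> weight (mnm_sub w (mesym1 s)) s = w.
Proof.
move=> sw; apply/mnmP => i; rewrite weightE mnmBE mnmE.
case: (boolP (i \in s)) => is_; last by rewrite subn0 addn0.
by move/fintype.subsetP: sw => /(_ i is_); rewrite inE; lia.
Qed.

Lemma wsupp_weight m s : s \subset wsupp (weight m s).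
Proof. by apply/fintype.subsetP => i is_; rewrite inE weightE is_ addn1. Qed.

Lemma wdeg_mdeg w : wdeg w = mdeg w.
Proof. by rewrite mdegE. Qed.

Lemma mdeg_weight m s : mdeg (weight m s) = (mdeg m + #|s|)%N.
Proof. by rewrite mdegD mdeg_mesym1. Qed.

(* The part of weight [w] of a form, where both [x_i] and [dx_i] have weight
   [mnm1 i]; it is determined by one coefficient for each [s]. *)
Definition wcomp w om s : R :=
  if s \subset wsupp w then mcoeff (mnm_sub w (mesym1 s)) (om s) else 0.

Lemma wcomp_weight m s om : wcomp (weight m s) om s = mcoeff m (om s).
Proof. by rewrite /wcomp wsupp_weight weightK. Qed.

Lemma wcomp0P om : (forall w s, wcomp w om s = 0) -> om = 0.
Proof.
move=> H; apply/ffunP => s; rewrite !ffunE; apply/mpolyP => m.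
by rewrite -wcomp_weight H mcoeff0.
Qed.

Lemma wcompD w om1 om2 s : wcomp w (om1 + om2) s = wcomp w om1 s + wcomp w om2 s.
Proof. by rewrite /wcomp; case: ifP => _; rewrite ?addr0 // ffunE mcoeffD. Qed.

Lemma wcompN w om s : wcomp w (- om) s = - wcomp w om s.
Proof. by rewrite /wcomp; case: ifP => _; rewrite ?oppr0 // ffunE mcoeffN. Qed.

Lemma wcomp0 w s : wcomp w (0 : pform R n) s = 0.
Proof. by rewrite /wcomp; case: ifP => _ //; rewrite ffunE mcoeff0. Qed.

Lemma wcomp_sum w (I : Type) (r : seq I) (P : pred I) (G : I -> pform R n) s :
  wcomp w (\sum_(j <- r | P j) G j) s = \sum_(j <- r | P j) wcomp w (G j) s.
Proof.
by elim/big_rec2: _ => [|j x y _ <-]; rewrite ?wcomp0 // wcompD.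
Qed.

Lemma mcoeff_sign m (b : nat) p : mcoeff m ((-1) ^+ b * p) = (-1) ^+ b * mcoeff m p.
Proof.
by rewrite -!(signr_odd _ b); case: (odd b); rewrite ?expr0 ?expr1 ?mul1r // !mulN1r mcoeffN.
Qed.

Lemma mcoeffXUM i p m :
  mcoeff m (mpolyX R (mnm1 i) * p) =
  if m i == 0%N then 0 else mcoeff (mnm_sub m (mnm1 i)) p.
Proof.
rewrite mulrC; case: ifPn => mi; last first.
  have <- : mnm_add (mnm1 i) (mnm_sub m (mnm1 i)) = m.
    by apply/mnmP => j; rewrite mnmDE mnmBE mnm1E; case: eqVneq => [<-|_]; lia.
  by rewrite mcoeffMX; congr mcoeff; apply/mnmP => j; rewrite !(mnmDE, mnmBE) addKn.
rewrite [p]mpolyE mulr_suml raddf_sum big1 // => k _ /=.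
rewrite -scalerAl -mpolyXD mcoeffZ mcoeffX; case: eqP => [E|]; last by rewrite mulr0.
by move: mi; rewrite -E mnmDE mnm1E eqxx addn1.
Qed.

(** In the monomial of weight [w] that contains [dx_(s :\ i)], the exponent of x_i is exactly [w i]:
    this is the factor in [Dx]. *)
Lemma wcomp_d w om : wcomp w (pform_d om) =1 Dx w (wcomp w om).
Proof.
move=> s; rewrite /Dx {1}/wcomp; case: ifPn => [sw|nsw]; last first.
  rewrite big1 // => i _; rewrite /ext_i /wcomp; case: ifP => is_; last by rewrite mulr0.
  case: ifPn => siw; last by rewrite !mulr0.
  have [->|wi] := eqVneq (w i) 0%N; first by rewrite mul0r.
  case/negP: nsw; apply/fintype.subsetP => j js.
  have [->|ji] := eqVneq j i; first by rewrite inE.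
  by apply: (fintype.subsetP siw); rewrite !inE ji.
rewrite ffunE raddf_sum big_mkcond; apply: eq_bigr => i _ /=; rewrite /ext_i.
case: ifPn => [is_|_]; last by rewrite mulr0.
rewrite mcoeff_sign mcoeff_deriv /wcomp.
rewrite (fintype.subset_trans _ sw) ?subD1set //.
have wi : w i != 0%N by move/fintype.subsetP: sw => /(_ i is_); rewrite inE.
have -> : mnm_add (mnm_sub w (mesym1 s)) (mnm1 i) = mnm_sub w (mesym1 (s :\ i)).
  apply/mnmP => j; rewrite !(mnmDE, mnmBE, mnmE, inE) eq_sym; case: eqVneq => [->|] /=.
    by rewrite is_; lia.
  by rewrite addn0.
have -> : (mnm_sub w (mesym1 s) i).+1 = w i.
  by rewrite mnmBE mnmE is_; lia.
by rewrite /sgn -[_ *+ w i]mulr_natl; ring.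
Qed.

Lemma wcomp_koszul w om : wcomp w (koszul om) =1 Kz (wcomp w om).
Proof.
move=> s; rewrite /Kz {1}/wcomp; case: ifPn => [sw|nsw]; last first.
  rewrite big1 // => i _; rewrite /int_i /wcomp; case: ifP => is_ //.
  rewrite ifF ?mulr0 //; apply: contraNF nsw; apply: fintype.subset_trans.
  exact: finset.subsetUr.
rewrite ffunE raddf_sum big_mkcond; apply: eq_bigr => i _ /=; rewrite /int_i.
case: ifPn => // is_; rewrite mcoeff_sign mcoeffXUM mnmBE mnmE (negPf is_) subn0 /wcomp.
rewrite finset.subUset sw andbT finset.sub1set inE; case: eqVneq => wi //=.
congr (_ * mcoeff _ _); apply/mnmP => j.
rewrite !(mnmBE, mnmE, inE) eq_sym; case: eqVneq => [->|] /=.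
  by rewrite (negPf is_); lia.
by rewrite subn0.
Qed.

Lemma pform_dd om : pform_d (pform_d om) = 0.
Proof.
by apply: wcomp0P => w s; rewrite wcomp_d (eq_Dx _ (wcomp_d w om)) DxDx.
Qed.

Definition mono m s : pform R n := [ffun t => if t == s then mpolyX R m else 0].

Lemma wcomp_mono w m s t : wcomp w (mono m s) t = ((t == s) && (w == weight m s))%:R.
Proof.
rewrite /wcomp ffunE; case: eqVneq => [->|_] /=; last by rewrite mcoeff0 if_same.
rewrite mcoeffX; case: ifPn => sw; last first.
  by case: eqP => // wE; move: sw; rewrite wE wsupp_weight.
congr (_%:R : R); congr nat_of_bool; apply/eqP/eqP => [->|->]; first by rewrite weight_sub.
by rewrite weightK.
Qed.

Definition SwForm r k om : Prop := is_kform k om /\ forall w, Sw r k w (wcomp w om).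

Lemma is_kformD k om1 om2 : is_kform k om1 -> is_kform k om2 -> is_kform k (om1 + om2).
Proof. by move=> h1 h2 s sk; rewrite ffunE h1 // h2 // addr0. Qed.

Lemma is_kform_sum (k : nat) (I : Type) (r : seq I) (P : pred I) (G : I -> pform R n) :
  (forall x, P x -> is_kform k (G x)) -> is_kform k (\sum_(j <- r | P j) G j).
Proof.
move=> H; elim/big_rec: _ => [|y x Pj hx]; first by move=> s _; rewrite ffunE.
by apply: is_kformD => //; exact: H.
Qed.

Lemma is_kform_d k om : is_kform k om -> is_kform k.+1 (pform_d om).
Proof.
move=> h s sk; rewrite ffunE big1 // => i is_; rewrite h ?raddf0 ?mulr0 //.
by move=> E; apply: sk; rewrite (cardsD1 i s) is_ E.
Qed.

Lemma is_kform_koszul k om : is_kform k.+1 om -> is_kform k (koszul om).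
Proof.
move=> h s sk; rewrite ffunE big1 // => i is_; rewrite h ?mulr0 //.
by rewrite cardsU1 is_ add1n => -[].
Qed.

Lemma ldeg_weight m s : ldeg m s = #|wlin (weight m s) :\: s|.
Proof.
rewrite /ldeg; apply: eq_card => i; apply/idP/idP => [/set_mem /= /andP[is_ mi]|].
  by rewrite !inE weightE (negPf is_) addn0.
move=> H; apply/mem_set => /=; move: H.
by rewrite !inE weightE => /andP[is_]; rewrite (negPf is_) addn0.
Qed.

Lemma wcomp_HlForm r l k om w : HlForm r l k om ->
  forall s, wcomp w om s != 0 -> [/\ #|s| = k, s \subset wsupp w,
    (l <= #|wlin w :\: s|)%N & mdeg w = (r + k)%N].
Proof.
move=> [[kom rom] lom] s; rewrite /wcomp; case: ifPn; last by rewrite eqxx.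
move=> sw cs; have ms : form_monomial om (mnm_sub w (mesym1 s)) s.
  by rewrite /form_monomial mcoeff_msupp.
have sk : #|s| = k.
  by apply: contrapT => /kom E; move: cs; rewrite E mcoeff0 eqxx.
split=> //; first by have := lom _ _ ms; rewrite ldeg_weight weight_sub.
by rewrite -(weight_sub sw) mdeg_weight (rom _ _ ms) sk.
Qed.

Lemma chain_sum (w : multinom n) (l k : nat) (I : Type) (q : seq I) (G : I -> {set 'I_n} -> R) :
  (forall x, chain w l k (G x)) -> chain w l k (fun s => \sum_(j <- q) G j s).
Proof.
move=> H; elim: q => [|j q IH].
  by apply: chain_eq (@chain0 R n w l k) => s; rewrite big_nil.
apply: (@chain_eq _ _ _ _ _ (fun s => 1 * G j s + 1 * \sum_(j <- q) G j s)).
  by move=> s; rewrite big_cons !mul1r.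
exact: chain_lin.
Qed.

Lemma wcomp_koszul_sum w N (h : nat -> pform R n) :
  wcomp w (\sum_(l < N) koszul (h l)) =1
  Kz (fun s => \sum_(l < N) wcomp w (h l) s).
Proof.
move=> s; rewrite wcomp_sum -[RHS]mul1r -KzZ; under eq_Kz do rewrite big_distrr.
by rewrite Kz_sum; apply: eq_bigr => l _; rewrite mul1r wcomp_koszul.
Qed.

(** The l-th piece has only weights of degree r + l + k + 1, so weight [w] sees at most the piece
    with l + 1 = mdeg w - (r + k), and l + 1 is the linear degree imposed on it. *)
Lemma JForm_chain r k om : JForm r k om ->
  is_kform k om /\ forall w, exists2 h,
    chain w (mdeg w - (r + k)) k.+1 h & wcomp w om =1 Kz h.
Proof.
move=> [N [h [hl ->]]]; split.
  apply: is_kform_sum => -[l lN] _; apply: is_kform_koszul.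
  by case: (hl l lN) => -[].
move=> w; exists (fun s => \sum_(l < N) wcomp w (h l) s); last exact: wcomp_koszul_sum.
apply: chain_sum => -[l lN] /= s cs.
by have [? ? ? E] := wcomp_HlForm (hl l lN) cs; split=> //; lia.
Qed.

Lemma JForm_pred_chain r k om : JForm_pred r.+1 k om -> 
  is_kform k (pform_d om) /\ forall w, exists2 h,
    chain w (mdeg w - (r + k)) k h & wcomp w om =1 Kz h.
Proof.
case: k => [->|k /JForm_chain[kom com]]; last first.
  split; first exact: is_kform_d.
  by move=> w; have [h ch E] := com w; exists h => //; rewrite addnS -addSn.
split; last first.
  by move=> w; exists (fun=> 0); [exact: chain0 | move=> s; rewrite wcomp0 Kz0].
by move=> s _; rewrite ffunE big1 // => i _; rewrite ffunE raddf0 mulr0.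
Qed.

(** P_r Lambda^k lives in weights of degree at most r + k, on which [Sw] imposes nothing; the J
    terms give [h] and [h']. *)
Lemma SForm_Sw r k om : SForm r k om -> SwForm r k om.
Proof.
move=> [p [j [j' [[kp rp] /JForm_chain[kj cj] /JForm_pred_chain[kj' cj'] ->]]]].
split; first by apply: is_kformD => //; exact: is_kformD.
move=> w; case: (leqP (mdeg w) (r + k)) => wr; first by left; rewrite wdeg_mdeg.
right; have [h ch E] := cj w; have [h' ch' E'] := cj' w.
exists h, h'; rewrite wdeg_mdeg; split=> // s; rewrite !wcompD E wcomp_d (eq_Dx _ E').
rewrite (_ : wcomp w p s = 0) ?add0r //; rewrite /wcomp; case: ifP => // sw.
apply/eqP; rewrite mcoeff_eq0; apply/negP => wp; have := rp _ _ wp.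
have sk : #|s| = k.
  by apply: contrapT => /kp E0; move: wp; rewrite E0 msupp0.
by move: wr; rewrite -(weight_sub sw) mdeg_weight sk weightK; lia.
Qed.

Lemma SwFormB r k om1 om2 : SwForm r k om1 -> SwForm r k om2 -> SwForm r k (om1 - om2).
Proof.
move=> [k1 h1] [k2 h2]; split=> [s sk|w]; first by rewrite !ffunE k1 // k2 // subrr.
apply: (Sw_eq (C := fun s => 1 * wcomp w om1 s + (-1) * wcomp w om2 s)).
  by move=> s; rewrite wcompD wcompN mul1r mulN1r.
exact: Sw_lin.
Qed.

Definition msubst i (c : R) p : mpoly n R :=
  comp_mpoly [tuple if j == i then mpolyC n c else mpolyX R (mnm1 j) | j < n] p.

Lemma meval_msubst i c p (x : 'rV[R]_n) :
  meval (x 0) (msubst i c p) = meval (set_coord x i c 0) p.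
Proof.
rewrite /msubst comp_mpoly_meval; apply: meval_eq => j.
by rewrite tnth_mktuple mxE; case: eqP => _; rewrite ?mevalC ?mevalXU.
Qed.

Definition mclear i m : multinom n := Multinom [tuple if j == i then 0%N else m j | j < n].

Lemma mclearE i m j : mclear i m j = if j == i then 0%N else m j.
Proof. exact: mnmE. Qed.

Lemma msubstX i c m : msubst i c (mpolyX R m) = c ^+ m i *: mpolyX R (mclear i m).
Proof.
rewrite /msubst comp_mpolyX (bigD1 i) //= tnth_mktuple eqxx -rmorphXn.
rewrite -mul_mpolyC; congr (_ * _); rewrite [in RHS]mpolyXE_id [in RHS](bigD1 i) //= mclearE eqxx.
rewrite expr0 mul1r; apply: eq_bigr => j /negPf ji.
by rewrite tnth_mktuple mclearE ji.
Qed.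

Lemma msubst_sum i c (J : Type) (r : seq J) (C : J -> R) (P : J -> mpoly n R) :
  msubst i c (\sum_(j <- r) C j *: P j) = \sum_(j <- r) C j *: msubst i c (P j).
Proof. by rewrite /msubst linear_sum; apply: eq_bigr => j _; rewrite linearZ. Qed.

Lemma msubstE i c p : msubst i c p =
  \sum_(m <- msupp p) mcoeff m p *: (c ^+ m i *: mpolyX R (mclear i m)).
Proof.
by rewrite {1}[p]mpolyE msubst_sum; apply: eq_bigr => m _; rewrite msubstX.
Qed.

Lemma mcoeff_msubst i c p m N : (forall m', m' \in msupp p -> (m' i < N)%N) ->
  mcoeff m (msubst i c p) = if m i == 0%N then
    \sum_(j < N) c ^+ j * mcoeff (mnm_add m (mnm_muln (mnm1 i) j)) p else 0.
Proof.
move=> pN; rewrite msubstE raddf_sum /=; under eq_bigr => m' _ do rewrite !mcoeffZ mcoeffX.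
case: ifPn => mi; last first.
  rewrite big1 // => m' _; case: eqP => [E|]; last by rewrite !mulr0.
  by move: mi; rewrite -E mnmE !eqxx.
under [RHS]eq_bigr => j _ do rewrite [p in mcoeff _ p]mpolyE raddf_sum big_distrr.
rewrite exchange_big big_seq [RHS]big_seq; apply: eq_bigr => m' m'p /=.
rewrite (bigD1 (Ordinal (pN _ m'p))) //= big1 ?addr0; last first.
  move=> j jm; rewrite mcoeffZ mcoeffX; case: eqP => [E|]; last by rewrite !mulr0.
  case/eqP: jm; apply/val_inj => /=; rewrite E mnmDE mulmnE mnm1E eqxx mul1n.
  by rewrite (eqP mi).
rewrite mcoeffZ mcoeffX mulrCA; congr (_ * (_ * _%:R)); congr nat_of_bool.
apply/eqP/eqP => [<-|E]; apply/mnmP => j.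
  rewrite mnmDE mnmE mulmnE mnm1E eq_sym; case: eqVneq => [->|]; first by rewrite mul1n.
  by rewrite mul0n addn0.
rewrite mnmE; case: eqVneq => [->|ji]; first by rewrite (eqP mi).
by rewrite E mnmDE mulmnE mnm1E eq_sym (negPf ji) mul0n addn0.
Qed.

Definition ptrace i (c : R) om : pform R n :=
  [ffun s : {set 'I_n} => if i \in s then 0 else msubst i c (om s)].

Definition wshift w i (j : nat) : multinom n := mnm_add w (mnm_muln (mnm1 i) j).

Lemma wshiftE w i (j : nat) i' : wshift w i j i' = (w i' + (i == i') * j)%N.
Proof. by rewrite mnmDE mulmnE mnm1E. Qed.

Lemma exp_bound om : exists N, forall s m, m \in msupp (om s) -> (mdeg m < N)%N.
Proof.
exists (\max_s msize (om s))%N => s m /msize_mdeg_lt ms; apply: leq_trans ms _.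
exact: (@leq_bigmax _ (fun s => msize (om s))).
Qed.

(** Putting x_i := c merges the weights w + j e_i, with factors c ^+ j. The length [N] may be any
    large number, so that the first two terms can be split off in [SwForm_deg]. *)
Lemma wcomp_ptrace om : exists N0, forall N, (N0 <= N)%N -> forall w i c, wcomp w (ptrace i c om) =1
  if w i == 0%N then
    fun s => \sum_(j < N) c ^+ j * restr i (wcomp (wshift w i j) om) s
  else fun=> 0.
Proof.
have [N0 HN] := exp_bound om; exists N0 => N N0N w i c s; rewrite {1}/wcomp ffunE.
case: (boolP (i \in s)) => is_.
  rewrite mcoeff0 if_same; case: ifP => //; rewrite /restr is_ => _.
  by rewrite big1 // => j _; rewrite mulr0.
rewrite (@mcoeff_msubst _ _ _ _ N); last first.
  move=> m /HN mN; apply: leq_ltn_trans (leq_trans mN N0N).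
  rewrite mdegE (bigD1 i) //=; exact: leq_addr.
rewrite mnmBE mnmE (negPf is_) subn0; case: (w i == 0%N) => /=; last by case: (_ \subset _).
have [sw|nsw] := boolP (s \subset wsupp w).
  apply: eq_bigr => j _; rewrite /restr (negPf is_) /wcomp.
  rewrite (fintype.subset_trans sw); last first.
    by apply/fintype.subsetP => x; rewrite !inE wshiftE; lia.
  congr (_ * mcoeff _ _); apply/mnmP => x; rewrite !(mnmDE, mnmBE, mulmnE, mnm1E, mnmE).
  case: eqVneq => [<-|]; last by rewrite mul0n !addn0.
  by rewrite (negPf is_) !subn0.
rewrite big1 // => j _; rewrite /restr (negPf is_) /wcomp ifF ?mulr0 //.
apply: contraNF nsw => /fintype.subsetP sw; apply/fintype.subsetP => x xs.
have := sw _ xs; rewrite !inE wshiftE; case: (eqVneq i x) => [ix|_]; last by rewrite addn0.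
by move: is_; rewrite ix xs.
Qed.

Lemma Sw_sum r k (w : 'I_n -> nat) (I : Type) (q : seq I) (c : I -> R)
    (G : I -> {set 'I_n} -> R) :
  (forall x, Sw r k w (G x)) -> Sw r k w (fun s => \sum_(j <- q) c j * G j s).
Proof.
move=> H; elim: q => [|x q IH].
  by apply: (Sw_eq (C := fun=> 0)) => [s|]; [rewrite big_nil | apply: Sw_chain; exact: chain0].
apply: (@Sw_eq _ _ _ _ _ (fun s => c x * G x s + 1 * \sum_(j <- q) c j * G j s)).
  by move=> s; rewrite big_cons mul1r.
exact: Sw_lin.
Qed.

Lemma SwForm_ptrace r k i c om : SwForm r k om -> SwForm r k (ptrace i c om).
Proof.
move=> [kom Som]; split.
  move=> s sk; rewrite ffunE kom //; case: ifP => // _; exact: raddf0.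
move=> w; have [N HN] := wcomp_ptrace om.
have -> : wcomp w (ptrace i c om) = _ := funext (HN _ (leqnn N) w i c).
case: ifP => [/eqP wi|_]; last by apply: Sw_chain; exact: chain0.
apply: Sw_sum => j; apply: (Sw_restr _ wi (Som (wshift w i j))) => x.
by rewrite wshiftE eq_sym => /negPf ->; rewrite mul0n addn0.
Qed.

Definition on_face F om : Prop := forall s m, m \in msupp (om s) ->
  s \subset F /\ forall i, i \notin F -> m i = 0%N.

Lemma msubst_supp i c p m : m \in msupp (msubst i c p) ->
  m i = 0%N /\ exists j : nat, wshift m i j \in msupp p.
Proof.
have : forall m', m' \in msupp p -> (m' i < msize p)%N.
  move=> m' /msize_mdeg_lt; apply: leq_ltn_trans; rewrite mdegE (bigD1 i) //=; exact: leq_addr.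
rewrite mcoeff_msupp => /mcoeff_msubst ->; case: (eqVneq (m i) 0%N) => [mi|]; last by rewrite /= eqxx.
move=> H; split=> //; apply: contrapT => E; move: H; rewrite big1 ?eqxx // => j _.
rewrite (_ : mcoeff _ _ = 0) ?mulr0 //; apply/eqP; rewrite mcoeff_eq0; apply/negP => ?.
by apply: E; exists j.
Qed.

Lemma on_face_ptrace F i c om : on_face F om -> on_face (F :\ i) (ptrace i c om).
Proof.
move=> H s m; rewrite ffunE; case: ifPn => is_; first by rewrite msupp0.
move=> /msubst_supp[mi [j /H[sF HF]]]; split; first by rewrite subsetD1 sF.
move=> x; rewrite !inE negb_and negbK => /orP[/eqP ->//|/HF].
by rewrite wshiftE => /eqP; rewrite addn_eq0 => /andP[/eqP].
Qed.

(* A coefficient of highest degree whose monomial has exponent at most 1 in [x_i]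
   can be read off the traces at [x_i = a i] and [x_i = b i]. *)
Lemma SwForm_deg r k F (a b : 'I_n -> R) om : (forall i, a i != b i) ->
  SwForm r k om -> on_face F om ->
  (forall i, i \in F -> ptrace i (a i) om = 0 /\ ptrace i (b i) om = 0) ->
  forall s m, m \in msupp (om s) -> (mdeg m <= r)%N.
Proof.
move=> ab [kom Som] Fom trom.
have top w : (r + k < mdeg w)%N -> forall s, wcomp w om s = 0.
  have [N HN] := exp_bound om.
  (* Descending induction on the degree of the weight: from N + n on nothing occurs, coefficients
     having degree below [N] and [dx_s] contributing at most [n]. *)
  have [m] := ubnP (N + n - mdeg w); elim: m w => // m IH w.
  rewrite ltnS => wm wr.
  have IH' w' : (mdeg w < mdeg w')%N -> forall s, wcomp w' om s = 0.
    move=> ww; have [wN|Nw] := leqP (N + n) (mdeg w); last by apply: IH; lia.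
    move=> s; rewrite /wcomp; case: ifP => // sw; apply/eqP; rewrite mcoeff_eq0.
    apply/negP => /HN; apply/negP; rewrite -leqNgt.
    move: ww; rewrite -(weight_sub sw) mdeg_weight.
    have := max_card s; rewrite card_ord weightK; lia.
  apply: (Sw_top (r := r) (k := k) (w := w)); [by rewrite wdeg_mdeg|exact: Som|].
  move=> s cs; have ms : mnm_sub w (mesym1 s) \in msupp (om s).
    by move: cs; rewrite /wcomp; case: ifP; rewrite ?eqxx // -mcoeff_msupp.
  have sw : s \subset wsupp w by move: cs; rewrite /wcomp; case: ifP; rewrite ?eqxx.
  split=> //.
    by apply: contrapT => /kom E; move: ms; rewrite E msupp0.
  apply/fintype.subsetP => i; rewrite inE => /eqP wi; apply: contraT => is_.
  have [sF mF] := Fom _ _ ms.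
  have iF : i \in F.
    by apply: contraT => /mF; rewrite mnmBE mnmE (negPf is_) wi.
  pose w' := mnm_sub w (mnm1 i).
  have w'i : w' i = 0%N by rewrite mnmBE mnm1E eqxx wi.
  have w'1 : wshift w' i 1 = w.
    apply/mnmP => x; rewrite wshiftE mnmBE mnm1E; case: eqVneq => [<-|]; rewrite ?wi //.
    by rewrite subn0 addn0.
  have w'0 : wshift w' i 0 = w'.
    by apply/mnmP => x; rewrite wshiftE muln0 addn0.
  have w'deg (j : nat) : mdeg (wshift w' i j) = (mdeg w' + j)%N.
    by rewrite mdegD mdegMn mdeg1 mul1n.
  have [N' HN'] := wcomp_ptrace om.
  (* The terms with j >= 2 have a weight of degree above that of [w] and vanish by induction; what
     remains is affine in c and has the two zeros [a i] and [b i]. *)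
  have lin c : ptrace i c om = 0 -> wcomp w' om s + c * wcomp w om s = 0.
    move=> tr0; have := HN' N'.+2 (leq_trans (leqnSn _) (leqnSn _)) w' i c s; rewrite tr0 wcomp0 w'i eqxx.
    rewrite 2!big_ord_recl big1 => [|j _]; last first.
      rewrite /restr (negPf is_) IH' ?mulr0 //.
      have -> : mdeg w = (mdeg w' + 1)%N by rewrite -(w'deg 1%N) w'1.
      by rewrite w'deg /= /bump /=; lia.
    by rewrite /restr (negPf is_) /= expr0 expr1 w'0 w'1 mul1r addr0 => <-.
  have [tra trb] := trom i iF.
  have := lin _ tra; have := lin _ trb => E1 E2.
  case/negP: cs; have : (a i - b i) * wcomp w om s = 0 by move: E1 E2; lra.
  by move/eqP; rewrite mulf_eq0 subr_eq0 (negPf (ab i)).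
move=> s m ms; rewrite leqNgt; apply/negP => mr.
have sk : #|s| = k by apply: contrapT => /kom E; move: ms; rewrite E msupp0.
move: ms; rewrite mcoeff_msupp -wcomp_weight top ?eqxx // mdeg_weight sk; lia.
Qed.
End Weights.

(** * Iterated integrals on a box *)

Section ParametricIntegral.
Variable R : realType.
Notation mu := (@lebesgue_measure R).

Lemma continuous_integrable (h : R -> R) (c d : R) : continuous h ->
  mu.-integrable `[c, d] (EFin \o h).
Proof.
move=> ch; apply: continuous_compact_integrable; first exact: segment_compact.
exact: continuous_subspaceT.
Qed.

(* Pointwise forms of [continuousD] and [continuousM]: on matrices, unification
   unfolds the neighborhood filter when [cvgD] or [cvgM] is applied. *)
Lemma continuous_for_add (T : topologicalType) (f g : T -> R) x :
  {for x, continuous f} -> {for x, continuous g} ->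
  {for x, continuous (fun y => f y + g y)}.
Proof. by move=> cf cg; exact: continuousD cf cg. Qed.

Lemma continuous_for_mul (T : topologicalType) (f g : T -> R) x :
  {for x, continuous f} -> {for x, continuous g} ->
  {for x, continuous (fun y => f y * g y)}.
Proof. by move=> cf cg; exact: continuousM cf cg. Qed.

Lemma pairr_continuous (T U : topologicalType) (y : T) : continuous (fun t : U => (y, t)).
Proof. by move=> t; apply: (@cvg_pair _ _ _ _ (nbhs y) (nbhs t)) => //; exact: cvg_cst. Qed.

Lemma Rintegral_norm_le (h : R -> R) (c d e : R) : c <= d -> continuous h ->
  (forall t, c <= t <= d -> `|h t| <= e) ->
  `|\int[mu]_(t in `[c, d]) h t| <= e * (d - c).
Proof.
move=> cd ch he; apply: (@le_trans _ _ (\int[mu]_(t in `[c, d]) `|h t|)).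
  by apply: le_normr_Rintegral => //; exact: continuous_integrable.
have cn : continuous (fun t => `|h t|).
  by move=> t; apply: (continuous_comp (ch t)); exact: norm_continuous.
apply: (@le_trans _ _ (\int[mu]_(t in `[c, d]) e)).
  apply: le_Rintegral => //; first exact: continuous_integrable.
    by apply: continuous_integrable => t; exact: cvg_cst.
rewrite Rintegral_cst //= lebesgue_measure_itv /= lte_fin.
by move: cd; rewrite le_eqVlt => /orP[/eqP ->|->//]; rewrite ltxx subrr.
Qed.

(** Tube lemma: compactness of the segment makes the continuity at [x] uniform in t. *)
Lemma near_segment_dist (T : topologicalType) (G : T * R -> R) (c d : R) (x : T) (e : R) :
  continuous G -> 0 < e ->
  \forall y \near x, forall t, c <= t <= d -> `|G (x, t) - G (y, t)| <= e.
Proof.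
move=> cG e0.
have /compact_near_coveringP/(_ T (nbhs x) (fun y t => `|G (x, t) - G (y, t)| <= e)) :=
  @segment_compact R c d.
move=> H; have {}H : \forall y \near x, `[c, d] `<=` (fun t => `|G (x, t) - G (y, t)| <= e).
  apply: H => t0 _.
  have /cvgrPdist_lt/(_ (e / 2)) := cG (x, t0); rewrite divr_gt0 // => /(_ isT).
  move=> [[A B] /= [nA nB] AB]; exists (B, A) => // -[t y] [/= Bt Ay].
  have := AB (x, t) (conj (nbhs_singleton nA) Bt); have := AB (y, t) (conj Ay Bt).
  rewrite /= => H1 H2; rewrite -(subrKA (G (x, t0))) (le_trans (ler_normD _ _)) //.
  by move: H1 H2; rewrite [X in _ -> X < _ -> _]distrC; lra.
by apply: filterS H => y Hy t tcd; apply: Hy; rewrite /= in_itv.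
Qed.

Lemma continuous_Rintegral (T : topologicalType) (G : T * R -> R) (c d : R) :
  c <= d -> continuous G ->
  continuous (fun x => \int[mu]_(t in `[c, d]) G (x, t)).
Proof.
move=> cd cG x; apply/cvgrPdist_le => e e0.
have cGx y : continuous (fun t => G (y, t)).
  move=> t; apply: (@continuous_comp _ _ _ (fun t => (y, t)) G); last exact: cG.
  exact: pairr_continuous.
(* Adding 1 covers the degenerate segment c = d. *)
have de : 0 < e / (d - c + 1) by apply: divr_gt0 => //; lra.
near=> y.
have H : forall t, c <= t <= d -> `|G (x, t) - G (y, t)| <= e / (d - c + 1).
  by near: y; exact: near_segment_dist.
rewrite -RintegralB //; [|exact: continuous_integrable..].
apply: le_trans (Rintegral_norm_le cd _ H) _.
  by move=> t; apply: cvgB; exact: cGx.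
rewrite -mulrA ler_piMr ?(ltW e0) // ler_pdivrMl; lra.
Unshelve. all: by end_near. Qed.

Lemma is_derive_Rintegral (G dG : R * R -> R) (c d u v y : R) :
  continuous G -> continuous dG -> u < y < v ->
  (forall z t, u < z < v -> c <= t <= d -> is_derive z 1 (fun z => G (z, t)) (dG (z, t))) ->
  is_derive y 1 (fun z => \int[mu]_(t in `[c, d]) G (z, t))
    (\int[mu]_(t in `[c, d]) dG (y, t)).
Proof.
move=> cG cdG yuv HG.
have cH (H : R * R -> R) z : continuous H -> continuous (fun t => H (z, t)).
  move=> cH t; apply: (@continuous_comp _ _ _ (fun t => (z, t)) H); last exact: cH.
  exact: pairr_continuous.
have := near_segment_dist c d y cdG ltr01.
move=> /nbhs_ballP[e /= e0 He].
pose u' := Num.max u (y - e); pose v' := Num.min v (y + e).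
have Iy : `]u', v'[%classic y.
  by rewrite /= in_itv /= /u' /v' gt_max lt_min; apply/andP; split; apply/andP; split; lra.
have Iuv z : `]u', v'[%classic z -> u < z < v /\ ball y e z.
  rewrite /= in_itv /= /u' /v' gt_max lt_min => /andP[/andP[? ?] /andP[? ?]].
  split; first lra; rewrite /ball /= ltr_norml; lra.
have E z t : `]u', v'[%classic z -> `[c, d]%classic t -> partial1of2 (fun z t => G (z, t)) z t = dG (z, t).
  move=> /Iuv[zuv _] tcd; rewrite partial1of2E.
  by have [_ ->] := HG z t zuv tcd.
have mI : measurable (`[c, d]%classic : set (measurableTypeR R)) by exact: measurable_itv.
(* Dominating function: for z in []u', v'[], dG (z, t) stays within 1 of dG (y, t), uniformly in
   t. *)
pose B t := `|dG (y, t)| + 1.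
have cB : continuous B.
  move=> t; apply: cvgD; last exact: cvg_cst.
  by apply: (continuous_comp (cH dG y cdG t)); exact: norm_continuous.
have derf z t : `]u', v'[%classic z -> `[c, d]%classic t -> derivable (fun z => G (z, t)) z 1.
  by move=> /Iuv[zuv _] tcd; have [] := HG z t zuv tcd.
have bd z t : `]u', v'[%classic z -> `[c, d]%classic t ->
    `|partial1of2 (fun z t => G (z, t)) z t| <= B t.
  move=> zI tcd; rewrite E // /B; have [_ /He/(_ t tcd)] := Iuv _ zI.
  by have := ler_normB (dG (y, t)) (dG (y, t) - dG (z, t)); rewrite subKr; lra.
have intf z : `]u', v'[%classic z -> mu.-integrable `[c, d] (EFin \o (fun t => G (z, t))).
  by move=> _; apply: continuous_integrable; exact: cH.
have B0 t : 0 <= B t by rewrite addr_ge0.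
have intB := @continuous_integrable B c d cB.
have D1 := derivable_under_integral mI Iy intf derf B0 intB bd.
have D2 := differentiation_under_integral mI Iy intf derf B0 intB bd.
apply: DeriveDef; first exact: D1.
rewrite -derive1E D2; apply: eq_Rintegral => t /set_mem tcd.
exact: E.
Qed.

End ParametricIntegral.

(** * Iterated integrals of continuous functions: linearity, differentiation, positivity *)

Section BoxIntegral.
Variables (R : realType) (n : nat) (a b : 'rV[R]_n).
Hypothesis ab : forall i, a 0 i < b 0 i.
Notation mu := (@lebesgue_measure R).
Implicit Types (f g h : 'rV[R]_n -> R) (i j : 'I_n) (l : seq 'I_n) (x : 'rV[R]_n).

Lemma set_coordE x i t j : set_coord x i t 0 j = if j == i then t else x 0 j.
Proof. by rewrite mxE. Qed.

Lemma set_coordC x i j t u : i != j ->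
  set_coord (set_coord x i t) j u = set_coord (set_coord x j u) i t.
Proof.
move=> ij; apply/rowP => k; rewrite !set_coordE.
by case: (eqVneq k j) => // ->; rewrite eq_sym (negPf ij).
Qed.

Lemma set_coord_set x i t u : set_coord (set_coord x i t) i u = set_coord x i u.
Proof. by apply/rowP => k; rewrite !set_coordE; case: eqP. Qed.

Lemma set_coord_id x i : set_coord x i (x 0 i) = x.
Proof. by apply/rowP => k; rewrite !set_coordE; case: eqP => // ->. Qed.

Lemma set_coord_add x i t : set_coord x i t = x + (t - x 0 i) *: delta_mx 0 i.
Proof.
apply/rowP => k; rewrite set_coordE !mxE eqxx /=; case: eqP => [->|_] /=.
  by rewrite mulr1 addrC subrK.
by rewrite mulr0 addr0.
Qed.

Lemma set_coord_continuous i :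
  continuous (fun p : 'rV[R]_n * R => set_coord p.1 i p.2).
Proof.
have -> : (fun p : 'rV[R]_n * R => set_coord p.1 i p.2) =
    (fun p : 'rV[R]_n * R => p.1 + (p.2 - p.1 0 i) *: delta_mx 0 i).
  by apply/funext => p; rewrite set_coord_add.
move=> p; apply: cvgD; first exact: cvg_fst.
apply: cvgZr_tmp.
apply: cvgB; first exact: cvg_snd.
apply: (@continuous_comp _ _ _ fst (fun x : 'rV[R]_n => x 0 i)); first exact: cvg_fst.
exact: coord_continuous.
Qed.

Lemma continuous_set_coord f i : continuous f ->
  continuous (fun p : 'rV[R]_n * R => f (set_coord p.1 i p.2)).
Proof.
move=> cf p; apply: (@continuous_comp _ _ _ (fun p => set_coord p.1 i p.2) f).
  exact: set_coord_continuous.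
exact: cf.
Qed.

Lemma continuous_set_coordl f i t : continuous f ->
  continuous (fun x => f (set_coord x i t)).
Proof.
move=> cf x; apply: (@continuous_comp _ _ _ (fun x => (x, t)) (fun p => f (set_coord p.1 i p.2))).
  exact: (@cvg_pair _ _ _ (nbhs x) (nbhs x) (nbhs t) _ _ _ id (cst t) cvg_id (cvg_cst _)).
exact: continuous_set_coord.
Qed.

Lemma continuous_set_coordr f i x : continuous f ->
  continuous (fun t => f (set_coord x i t)).
Proof.
move=> cf t; apply: (@continuous_comp _ _ _ (fun t => (x, t)) (fun p => f (set_coord p.1 i p.2))).
  exact: pairr_continuous.
exact: continuous_set_coord.
Qed.

Notation I := (iter_integral a b).

Lemma iter_integral_continuous l f : continuous f -> continuous (I l f).
Proof.
move=> cf; elim: l => //= i l IH.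
apply: (continuous_Rintegral (G := fun p => I l f (set_coord p.1 i p.2))).
  exact: ltW.
exact: continuous_set_coord.
Qed.

Lemma iter_integral_integrable l f i x : continuous f ->
  mu.-integrable `[a 0 i, b 0 i] (EFin \o (fun t => I l f (set_coord x i t))).
Proof.
by move=> cf; apply/continuous_integrable/continuous_set_coordr/iter_integral_continuous.
Qed.

Lemma iter_integral_lin l f g (c d : R) x : continuous f -> continuous g ->
  I l (fun x => c * f x + d * g x) x = c * I l f x + d * I l g x.
Proof.
move=> cf cg; elim: l x => //= i l IH x.
under eq_Rintegral do rewrite IH.
have ch h (e : R) : continuous h -> mu.-integrable `[a 0 i, b 0 i]
    (EFin \o (fun t => e * I l h (set_coord x i t))).
  move=> ch; apply: continuous_integrable => t; apply: cvgM; first exact: cvg_cst.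
  by apply: continuous_set_coordr; exact: iter_integral_continuous.
by rewrite RintegralD ?ch // !RintegralZl //; exact: iter_integral_integrable.
Qed.

Lemma iter_integral0 l x : I l (fun=> 0) x = 0.
Proof.
elim: l x => //= i l IH x; under eq_Rintegral do rewrite IH.
by rewrite Rintegral_cst // mul0r.
Qed.

Lemma iter_integral_sum (J : Type) (q : seq J) l (c : J -> R) (G : J -> 'rV[R]_n -> R) x :
  (forall y, continuous (G y)) ->
  I l (fun x => \sum_(j <- q) c j * G j x) x = \sum_(j <- q) c j * I l (G j) x.
Proof.
move=> cG.
have cS q' : continuous (fun x => \sum_(j <- q') c j * G j x).
  elim: q' => [|j q' IH].
    have -> : (fun x => \sum_(j <- [::]) c j * G j x) = cst 0.
      by apply/funext => y; rewrite big_nil.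
    exact: cst_continuous.
  have -> : (fun x => \sum_(j0 <- j :: q') c j0 * G j0 x) =
      (fun y => c j * G j y + \sum_(j <- q') c j * G j y).
    by apply/funext => y; rewrite big_cons.
  move=> y; apply: continuous_for_add (IH y).
  by apply: continuous_for_mul (cG j y); exact: cst_continuous.
elim: q => [|j q IH].
  rewrite big_nil -[RHS](iter_integral0 l x); congr iter_integral; apply/funext => y.
  by rewrite big_nil.
rewrite big_cons -IH -[X in _ + X]mul1r -iter_integral_lin //.
by congr iter_integral; apply/funext => y; rewrite big_cons mul1r.
Qed.

Lemma iter_integral_cat l1 l2 f : I (l1 ++ l2) f = I l1 (I l2 f).
Proof.
elim: l1 => //= i l IH; apply/funext => x; by rewrite IH.
Qed.

Lemma iter_integral_set_coord l i t f x : i \notin l ->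
  I l (fun y => f (set_coord y i t)) x = I l f (set_coord x i t).
Proof.
elim: l x => //= j l IH x; rewrite inE negb_or => /andP[ij il].
by apply: eq_Rintegral => u _; rewrite IH // (set_coordC _ _ _ ij).
Qed.

Lemma eq_iter_integral l f g x :
  (forall y : 'rV[R]_n, (forall i, y 0 i = x 0 i \/ i \in l /\ a 0 i <= y 0 i <= b 0 i) -> f y = g y) ->
  I l f x = I l g x.
Proof.
elim: l x => [|i l IH] x H /=; first by apply: H => i; left.
apply: eq_Rintegral => t /set_mem /=; rewrite in_itv /= => tI.
apply: IH => y Hy; apply: H => j; have [E|[jl jI]] := Hy j; last first.
  by right; rewrite inE jl orbT.
move: E; rewrite set_coordE; case: (eqVneq j i) => [->|_] E; last by left.
by right; rewrite inE eqxx E.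
Qed.

(** Only the i-th coordinate is confined to its open interval; the other ones are arbitrary.
    Composition with [clamp] produces exactly this kind of derivative. *)
Definition is_partial i f g : Prop := forall x, a 0 i < x 0 i < b 0 i ->
  is_derive (x 0 i) 1 (fun t => f (set_coord x i t)) (g x).

Lemma is_partial_iter l i f g : continuous f -> continuous g -> i \notin l ->
  is_partial i f g -> is_partial i (I l f) (I l g).
Proof.
move=> cf cg; elim: l => //= j l IH; rewrite inE negb_or => /andP[ij il] fg x xi.
have {}IH := IH il fg.
pose G h (p : R * R) := I l h (set_coord (set_coord x j p.2) i p.1).
have cG h : continuous h -> continuous (G h).
  move=> ch p; apply: (@continuous_comp _ _ _ (fun p => (set_coord x j p.2, p.1))
    (fun q => I l h (set_coord q.1 i q.2))); last first.
    by apply: continuous_set_coord; exact: iter_integral_continuous.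
  apply: (@cvg_pair _ _ _ (nbhs p) (nbhs (set_coord x j p.2)) (nbhs p.1) _ _ _
    (fun q => set_coord x j q.2) (fun q => q.1)); last exact: cvg_fst.
  apply: (@continuous_comp _ _ _ snd (fun t => set_coord x j t)); first exact: cvg_snd.
  apply: (@continuous_comp _ _ _ (fun t => (x, t)) (fun p => set_coord p.1 j p.2)).
    exact: pairr_continuous.
  exact: set_coord_continuous.
have := @is_derive_Rintegral R (G f) (G g) (a 0 j) (b 0 j) (a 0 i) (b 0 i) (x 0 i)
  (cG f cf) (cG g cg) xi.
rewrite /G /= (_ : (fun _ => _) = (fun t => \int[mu]_(u in `[a 0 j, b 0 j]) I l f (set_coord (set_coord x i t) j u))); last first.
  by apply/funext => t; apply: eq_Rintegral => u _; rewrite (set_coordC _ _ _ ij).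
rewrite (_ : \int[mu]_(t in _) _ = \int[mu]_(t in `[a 0 j, b 0 j]) I l g (set_coord x j t)); last first.
  apply: eq_Rintegral => u _; congr iter_integral; apply/rowP => k; rewrite !set_coordE.
  by case: (eqVneq k i) => [->|//]; rewrite (negPf ij).
apply=> z t zi tj.
have := IH (set_coord (set_coord x j t) i z); rewrite set_coordE eqxx => /(_ zi).
by under eq_fun do rewrite set_coord_set.
Qed.

Lemma Rintegral_partial i f g x : continuous f -> continuous g -> is_partial i f g ->
  \int[mu]_(t in `[a 0 i, b 0 i]) g (set_coord x i t) =
  f (set_coord x i (b 0 i)) - f (set_coord x i (a 0 i)).
Proof.
move=> cf cg fg; rewrite /Rintegral.
have D t : a 0 i < t < b 0 i -> is_derive t 1 (fun t => f (set_coord x i t)) (g (set_coord x i t)).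
  move=> tI; have := fg (set_coord x i t); rewrite set_coordE eqxx => /(_ tI).
  by under eq_fun do rewrite set_coord_set.
have c1 := @continuous_set_coordr f i x cf.
have c2 := @continuous_set_coordr g i x cg.
rewrite (@continuous_FTC2 _ (fun t => g (set_coord x i t)) (fun t => f (set_coord x i t))) //.
- exact: continuous_subspaceT.
- split.
  + by move=> t; rewrite in_itv /= => /D[].
  + by apply: cvg_at_right_filter; exact: c1.
  + by apply: cvg_at_left_filter; exact: c1.
- by move=> t; rewrite in_itv /= => /D[_ <-]; rewrite derive1E.
Qed.

Lemma iter_integral_partial l1 l2 i f g x : i \notin l1 -> i \notin l2 ->
  continuous f -> continuous g -> is_partial i f g ->
  I (l1 ++ i :: l2) g x =
  I (l1 ++ l2) f (set_coord x i (b 0 i)) - I (l1 ++ l2) f (set_coord x i (a 0 i)).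
Proof.
move=> il1 il2 cf cg fg; rewrite !iter_integral_cat /=.
rewrite -!(iter_integral_set_coord _ _ _ il1).
rewrite (_ : (fun _ => _) = (fun y => 1 * I l2 f (set_coord y i (b 0 i)) + (-1) * I l2 f (set_coord y i (a 0 i)))).
  rewrite iter_integral_lin ?mul1r ?mulN1r //; apply: continuous_set_coordl;
  exact: iter_integral_continuous.
apply/funext => y; rewrite mul1r mulN1r.
by apply: Rintegral_partial; [exact: iter_integral_continuous..|exact: is_partial_iter].
Qed.

Lemma iter_integral_ge0 l f x : (forall y, 0 <= f y) -> 0 <= I l f x.
Proof. by move=> f0; elim: l x => //= i l IH x; exact: Rintegral_ge0. Qed.

Lemma iter_integral_eq0 l f x : continuous f -> (forall y, 0 <= f y) -> I l f x = 0 ->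
  forall y : 'rV[R]_n, (forall i, if i \in l then a 0 i < y 0 i < b 0 i : Prop else y 0 i = x 0 i) -> f y = 0.
Proof.
move=> cf f0; elim: l x => [|i l IH] x /= I0 y yl.
  by rewrite (_ : y = x) //; apply/rowP => i; exact: yl.
pose F t := I l f (set_coord x i t).
have cF : continuous F by apply: continuous_set_coordr; exact: iter_integral_continuous.
have F0 t : 0 <= F t by exact: iter_integral_ge0.
have yi : a 0 i < y 0 i < b 0 i by have := yl i; rewrite mem_head.
apply: (IH (set_coord x i (y 0 i))); last first.
  move=> j; have := yl j; rewrite set_coordE inE; case: (eqVneq j i) => [->|//] /=.
  by case: ifP.
apply/eqP; rewrite eq_le F0 andbT leNgt; apply/negP => Fy.
have [e e0 He] : exists2 e, 0 < e & forall t, `|y 0 i - t| < e -> F (y 0 i) / 2 < F t.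
  have /cvgrPdist_lt/(_ (F (y 0 i) / 2)) := cF (y 0 i); rewrite divr_gt0 // => /(_ isT).
  move=> /nbhs_ballP[e e0 He]; exists e => // t /He /=; rewrite ltr_norml; lra.
(* A segment of positive length around [y 0 i], inside the domain of integration, on which F exceeds
   half of its value at [y 0 i]. *)
pose u := Num.max (a 0 i) (y 0 i - e / 2); pose v := Num.min (b 0 i) (y 0 i + e / 2).
have uv : [/\ a 0 i <= u, v <= b 0 i, u < v, y 0 i - e / 2 <= u & v <= y 0 i + e / 2].
  rewrite /u /v !le_max !ge_min !gt_max !lt_min !lexx !orbT; split=> //.
  by move: (ab i) yi e0; lra.
have [au vb uv' ue ve] := uv.
have : 0 < \int[mu]_(t in `[a 0 i, b 0 i]) F t.
  have : \int[mu]_(t in `[u, v]) (F (y 0 i) / 2) <= \int[mu]_(t in `[u, v]) F t.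
    apply: le_Rintegral => //; last 1 first.
    - move=> t /=; rewrite in_itv /= => /andP[ut tv]; apply/ltW/He.
      by rewrite ltr_norml; move: e0; lra.
    - by apply: continuous_integrable => t; exact: cvg_cst.
    - exact: continuous_integrable.
  rewrite Rintegral_cst //= lebesgue_measure_itv /= lte_fin uv' /= => H.
  have {}H : 0 < \int[mu]_(t in `[u, v]) F t.
    by apply: lt_le_trans H; rewrite mulr_gt0 ?subr_gt0 // divr_gt0.
  apply: lt_le_trans H _.
  apply: fine_le; do ?by apply: integrable_fin_num => //; exact: continuous_integrable.
  apply: ge0_subset_integral => //.
  - by have /integrableP[] := @continuous_integrable _ F (a 0 i) (b 0 i) cF.
  - by move=> t _; rewrite lee_fin.
  - by move=> t /=; rewrite !in_itv /=; move: au vb; lra.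
by rewrite I0 ltxx.
Qed.

End BoxIntegral.

(** * Extension to functions controlled only on the box *)

Section ClampedIntegral.
Variables (R : realType) (n : nat) (a b : 'rV[R]_n).
Hypothesis ab : forall i, a 0 i < b 0 i.
Notation mu := (@lebesgue_measure R).
Implicit Types (f g h : 'rV[R]_n -> R) (i j : 'I_n) (l : seq 'I_n) (x : 'rV[R]_n).
Notation I := (iter_integral a b).

(** Retraction of R^n onto the box. Composing with it does not change integrals over faces, and
    turns continuity at the points of the box into continuity on R^n. *)
Definition clamp x : 'rV[R]_n := \row_i Num.max (a 0 i) (Num.min (b 0 i) (x 0 i)).

Lemma clampE x i : clamp x 0 i = Num.max (a 0 i) (Num.min (b 0 i) (x 0 i)).
Proof. by rewrite mxE. Qed.

Lemma clamp_box x : box a b (clamp x).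
Proof.
move=> i; rewrite clampE le_max lexx ge_max ge_min lexx /=.
by rewrite andbT ltW.
Qed.

Lemma clamp_coord x i : a 0 i <= x 0 i <= b 0 i -> clamp x 0 i = x 0 i.
Proof.
move=> /andP[ax xb]; rewrite clampE.
by rewrite (min_idPr xb) (max_idPr ax).
Qed.

Lemma clamp_id x : box a b x -> clamp x = x.
Proof. by move=> xB; apply/rowP => i; exact: clamp_coord. Qed.

Lemma max_min_lip (c d u v e : R) : c < d -> `|u - v| < e ->
  `|Num.max c (Num.min d u) - Num.max c (Num.min d v)| < e.
Proof.
move=> cd; rewrite !ltr_norml.
have [du|du] := leP d u; have [dv|dv] := leP d v; have [h1|h1] := leP c d; try lra.
- by have [h2|h2] := leP c v; lra.
- by have [h2|h2] := leP c u; lra.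
- by have [h2|h2] := leP c u; have [h3|h3] := leP c v; lra.
Qed.

Lemma clamp_continuous : continuous clamp.
Proof.
move=> x s /= /(nbhs_ballP (clamp x)) [e e0 es].
apply/nbhs_ballP; exists e => //= y [_ xy]; apply: es; split=> // i j.
have := xy i j; rewrite /ball /= !mxE (ord1 i); exact: max_min_lip.
Qed.

Definition bcont f : Prop := forall x, box a b x -> {for x, continuous f}.

Lemma bcont_clamp f : bcont f -> continuous (f \o clamp).
Proof.
move=> cf x; apply: continuous_comp; first exact: clamp_continuous.
exact/cf/clamp_box.
Qed.

Lemma iter_integral_clamp l f x : box a b x -> I l f x = I l (f \o clamp) x.
Proof.
move=> xB; apply: eq_iter_integral => y Hy; rewrite /= clamp_id // => i.
by have [->|[_]] := Hy i.
Qed.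

Definition is_bpartial i f g : Prop := forall x, box a b x -> a 0 i < x 0 i < b 0 i ->
  is_derive (x 0 i) 1 (fun t => f (set_coord x i t)) (g x).

Lemma clamp_set_coord x i t : a 0 i <= t <= b 0 i ->
  clamp (set_coord x i t) = set_coord (clamp x) i t.
Proof.
move=> tI; apply/rowP => j; rewrite set_coordE; case: (eqVneq j i) => [->|ji].
  by rewrite clamp_coord set_coordE eqxx.
by rewrite !clampE set_coordE (negPf ji).
Qed.

Lemma is_partial_clamp i f g : is_bpartial i f g -> is_partial a b i (f \o clamp) (g \o clamp).
Proof.
move=> fg x xi; have xi' : a 0 i <= x 0 i <= b 0 i by move: xi; lra.
have := fg (clamp x) (clamp_box x); rewrite clamp_coord // => /(_ xi) H.
apply: near_eq_is_derive H.
near=> t; rewrite /= clamp_set_coord //.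
have : t \in `]a 0 i, b 0 i[ by near: t; apply: near_in_itvoo; rewrite in_itv.
by rewrite in_itv /=; lra.
Unshelve. all: by end_near. Qed.

Lemma box_integral_sum (J : Type) (q : seq J) l (c : J -> R) (G : J -> 'rV[R]_n -> R) x :
  box a b x -> (forall y, bcont (G y)) ->
  I l (fun x => \sum_(j <- q) c j * G j x) x = \sum_(j <- q) c j * I l (G j) x.
Proof.
move=> xB cG; rewrite iter_integral_clamp // .
rewrite -[LHS]/(I l (fun x => \sum_(j <- q) c j * (G j \o clamp) x) x).
rewrite (iter_integral_sum ab); last by move=> j; exact: bcont_clamp.
by apply: eq_bigr => j _; rewrite -iter_integral_clamp.
Qed.

Lemma box_integral_lin l f g (c d : R) x : box a b x -> bcont f -> bcont g ->
  I l (fun x => c * f x + d * g x) x = c * I l f x + d * I l g x.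
Proof.
move=> xB cf cg; rewrite (iter_integral_clamp _ _ xB) (iter_integral_clamp l f xB) (iter_integral_clamp l g xB).
rewrite -[LHS]/(I l (fun x => c * (f \o clamp) x + d * (g \o clamp) x) x).
by rewrite iter_integral_lin //; exact: bcont_clamp.
Qed.

Lemma box_set_coord x i t : box a b x -> a 0 i <= t <= b 0 i -> box a b (set_coord x i t).
Proof. by move=> xB tI j; rewrite set_coordE; case: (eqVneq j i) => [->|_]. Qed.

Lemma box_integral_partial l1 l2 i f g x : i \notin l1 -> i \notin l2 ->
  box a b x -> bcont f -> bcont g -> is_bpartial i f g ->
  I (l1 ++ i :: l2) g x =
  I (l1 ++ l2) f (set_coord x i (b 0 i)) - I (l1 ++ l2) f (set_coord x i (a 0 i)).
Proof.
move=> il1 il2 xB cf cg fg; have abi := ab i.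
have Ha : a 0 i <= a 0 i <= b 0 i by lra.
have Hb : a 0 i <= b 0 i <= b 0 i by lra.
rewrite (iter_integral_clamp _ _ xB) (iter_integral_clamp _ _ (box_set_coord xB Hb)).
rewrite (iter_integral_clamp _ _ (box_set_coord xB Ha)).
by apply: iter_integral_partial => //; [exact: bcont_clamp..|exact: is_partial_clamp].
Qed.

Lemma box_integral_sqr_eq0 l f x : box a b x -> bcont f -> I l (fun y => f y ^+ 2) x = 0 ->
  forall y : 'rV[R]_n, (forall i, if i \in l then a 0 i < y 0 i < b 0 i : Prop else y 0 i = x 0 i) -> f y = 0.
Proof.
move=> xB cf; rewrite iter_integral_clamp // => I0 y Hy.
have yB : box a b y.
  by move=> i; have := Hy i; case: ifP => _; [lra | move=> ->; exact: xB].
have cf2 : continuous (fun y => (f \o clamp) y ^+ 2).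
  by move=> z; apply: continuous_for_mul; exact: bcont_clamp.
have := @iter_integral_eq0 R n a b ab l (fun y => (f \o clamp) y ^+ 2) x cf2 (fun z => sqr_ge0 _) I0 y Hy.
by rewrite /= clamp_id // => /eqP; rewrite sqrf_eq0 => /eqP.
Qed.

Lemma bcontM f g : bcont f -> bcont g -> bcont (fun x => f x * g x).
Proof. by move=> cf cg x xB; apply: continuous_for_mul; [exact: cf|exact: cg]. Qed.

Lemma bcontD f g : bcont f -> bcont g -> bcont (fun x => f x + g x).
Proof. by move=> cf cg x xB; apply: continuous_for_add; [exact: cf|exact: cg]. Qed.

Lemma vertex_box e : box a b (vertex a b e).
Proof. by move=> i; rewrite mxE; have := ab i; case: ifP => _; lra. Qed.

End ClampedIntegral.

(** * Polynomials as functions: continuity, derivatives, vanishing on an open box *)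

Section PolynomialFunctions.
Local Close Scope classical_set_scope.
Local Open Scope set_scope.
Variables (R : realType) (n : nat).
Implicit Types (i j : 'I_n) (s : {set 'I_n}) (m : multinom n).
Implicit Types (p q : mpoly n R) (x : 'rV[R]_n).

Definition pfun p : 'rV[R]_n -> R := fun x => meval (x 0) p.

Lemma pfunM p q x : pfun (p * q) x = pfun p x * pfun q x.
Proof. exact: mevalM. Qed.

Lemma pfunE p x : pfun p x = \sum_(m <- msupp p) mcoeff m p * \prod_i x 0 i ^+ m i.
Proof. exact: mevalE. Qed.

Lemma continuous_for_sum (T : topologicalType) (J : Type) (r : seq J) (P : pred J)
    (G : J -> T -> R) (z : T) :
  (forall y, {for z, continuous (G y)}) ->
  {for z, continuous (fun y => \sum_(j <- r | P j) G j y)}.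
Proof.
move=> cG; elim: r => [|j r IH].
  have -> : (fun y => \sum_(j <- [::] | P j) G j y) = cst 0.
    by apply/funext => y; rewrite big_nil.
  exact: cst_continuous.
have [Pj|/negPf Pj] := boolP (P j).
  have -> : (fun y => \sum_(j0 <- j :: r | P j0) G j0 y) =
      (fun y => G j y + \sum_(j0 <- r | P j0) G j0 y).
    by apply/funext => y; rewrite big_cons Pj.
  exact: continuous_for_add.
have -> : (fun y => \sum_(j0 <- j :: r | P j0) G j0 y) =
    (fun y => \sum_(j0 <- r | P j0) G j0 y).
  by apply/funext => y; rewrite big_cons Pj.
exact: IH.
Qed.

Lemma continuous_for_exp (T : topologicalType) (f : T -> R) k (z : T) :
  {for z, continuous f} -> {for z, continuous (fun y => f y ^+ k)}.
Proof.
move=> cf; elim: k => [|k IH].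
  have -> : (fun y => f y ^+ 0) = cst 1 by apply/funext => y; rewrite expr0.
  exact: cst_continuous.
have -> : (fun y => f y ^+ k.+1) = (fun y => f y * f y ^+ k).
  by apply/funext => y; rewrite exprS.
exact: continuous_for_mul.
Qed.

Lemma pfun_continuous p : continuous (pfun p).
Proof.
have -> : pfun p = fun x => \sum_(m <- msupp p) mcoeff m p * \prod_i x 0 i ^+ m i.
  by apply/funext => x; rewrite pfunE.
move=> z; apply: continuous_for_sum => m; apply: continuous_for_mul.
  exact: cst_continuous.
elim: (index_enum _) => [|j r IH].
  have -> : (fun y : 'rV[R]_n => \prod_(i <- [::]) y 0 i ^+ m i) = cst 1.
    by apply/funext => y; rewrite big_nil.
  exact: cst_continuous.
have -> : (fun y : 'rV[R]_n => \prod_(i <- j :: r) y 0 i ^+ m i) =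
    (fun y : 'rV[R]_n => y 0 j ^+ m j * \prod_(i <- r) y 0 i ^+ m i).
  by apply/funext => y; rewrite big_cons.
apply: continuous_for_mul IH; apply: continuous_for_exp; exact: coord_continuous.
Qed.

Lemma mderivE i p : mderiv i p = \sum_(m <- msupp p) mcoeff m p *: ((m i)%:R *: mpolyX R (mnm_sub m (mnm1 i))).
Proof.
rewrite {1}[p]mpolyE linear_sum; apply: eq_bigr => m _ /=.
by rewrite mderivZ mderivX.
Qed.

Lemma is_derive_pfun i p x (t : R) :
  is_derive t 1 (fun t : R => pfun p (set_coord x i t)) (pfun (mderiv i p) (set_coord x i t)).
Proof.
pose c m := mcoeff m p * \prod_(j | j != i) x 0 j ^+ m j.
pose P : {poly R} := \sum_(m <- msupp p) (c m)%:P * 'X^(m i).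
have E u : pfun p (set_coord x i u) = P.[u].
  rewrite pfunE /P horner_sum; apply: eq_bigr => m _.
  rewrite hornerM hornerC hornerXn /c -mulrA; congr (_ * _).
  rewrite (bigD1 i) //= set_coordE eqxx mulrC; congr (_ * _).
  by apply: eq_bigr => j /negPf ji; rewrite set_coordE ji.
have -> : (fun u => pfun p (set_coord x i u)) = horner P by apply/funext => u; exact: E.
have -> : pfun (mderiv i p) (set_coord x i t) = P^`().[t].
  rewrite /P raddf_sum /= horner_sum mderivE /pfun raddf_sum /=.
  apply: eq_bigr => m _; rewrite !mevalZ mevalX derivM derivC mul0r add0r derivXn.
  rewrite hornerM hornerC hornerMn hornerXn /c -mulrA; congr (_ * _).
  rewrite (bigD1 i) //= set_coordE eqxx mnmBE mnm1E eqxx subn1.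
  rewrite -[_ *+ m i]mulr_natl mulrA mulrC; congr (_ * _); last first.
    by rewrite mulr1 mulr_natl.
  apply: eq_bigr => j ji; rewrite set_coordE (negPf ji) mnmBE mnm1E eq_sym (negPf ji).
  by rewrite subn0.
exact: is_derive_poly.
Qed.

Lemma is_derive_delta i (f : 'rV[R]_n -> R) x d :
  is_derive x (delta_mx 0 i) f d <->
  is_derive (x 0 i) 1 (fun t => f (set_coord x i t)) d.
Proof.
have E : (fun h : R => h^-1 *: ((f \o shift x) (h *: delta_mx 0 i) - f x)) =
   (fun h : R => h^-1 *: (((fun t => f (set_coord x i t)) \o shift (x 0 i)) (h *: 1)
     - f (set_coord x i (x 0 i)))).
  apply/funext => u; rewrite set_coord_id /= set_coord_add addrK -[u *: 1]/(u * 1) mulr1.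
  by congr (_ *: (f _ - _)); exact: addrC.
split=> -[H1 H2]; split.
- by rewrite /derivable -E.
- by rewrite /derive -E.
- by rewrite /derivable E.
- by rewrite /derive E.
Qed.

Lemma partial_pfun i p : partial i (pfun p) = pfun (mderiv i p).
Proof.
apply/funext => x; have /is_derive_delta[_ E] := is_derive_pfun i p x (x 0 i).
by rewrite /partial E set_coord_id.
Qed.

Lemma eval_formE (w : pform R n) s : eval_form w s = pfun (w s).
Proof. by rewrite ffunE. Qed.

Lemma fct_signE (k : nat) (f : 'rV[R]_n -> R) x : ((-1) ^+ k * f) x = (-1) ^+ k * f x.
Proof.
by rewrite -!(signr_odd _ k); case: (odd k); rewrite ?expr0 ?expr1 ?mul1r // !mulN1r.
Qed.

Lemma fform_d_eval (w : pform R n) : fform_d (eval_form w) = eval_form (pform_d w).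
Proof.
apply/ffunP => s; rewrite !ffunE; apply/funext => x; rewrite fct_sumE raddf_sum /=.
apply: eq_bigr => i is_; rewrite fct_signE eval_formE partial_pfun.
by rewrite -!(signr_odd _ (inversions _ _)); case: odd; rewrite ?expr0 ?expr1 ?mul1r // !mulN1r mevalN.
Qed.

Variables (a b : 'rV[R]_n).
Hypothesis ab : forall i, a 0 i < b 0 i.
Notation I := (iter_integral a b).

Lemma bcont_pfun p : bcont a b (pfun p).
Proof. by move=> x _; exact: pfun_continuous. Qed.

Lemma is_bpartial_pfun i p : is_bpartial a b i (pfun p) (pfun (mderiv i p)).
Proof.
by move=> x _ _; have := is_derive_pfun i p x (x 0 i); rewrite set_coord_id.
Qed.

Lemma mderiv_supp i p m : m \in msupp (mderiv i p) -> mnm_add m (mnm1 i) \in msupp p.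
Proof.
rewrite !mcoeff_msupp mcoeff_deriv; apply: contra_neq => ->.
by rewrite mul0rn.
Qed.

Lemma mderiv_eq0 i p m : mderiv i p = 0 -> m i != 0%N -> mcoeff m p = 0.
Proof.
move=> dp mi; have := mcoeff_deriv i (mnm_sub m (mnm1 i)) p; rewrite dp mcoeff0.
have -> : mnm_add (mnm_sub m (mnm1 i)) (mnm1 i) = m.
  by apply/mnmP => j; rewrite mnmDE mnmBE mnm1E; case: eqVneq => [<-|_]; lia.
by move/esym/eqP; rewrite mulrn_eq0 => /eqP.
Qed.

(** Induction on the degree: the partial derivatives also vanish on the open box, hence are 0, so p
    is a constant, evaluated at the midpoint. *)
Lemma pfun_zero p : (forall x, (forall i, a 0 i < x 0 i < b 0 i) -> pfun p x = 0) -> p = 0.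
Proof.
have : forall m, m \in msupp p -> (mdeg m < msize p)%N by move=> m /msize_mdeg_lt.
move: (msize p) => N; elim: N p => [|N IH] p pN p0.
  apply/mpolyP => m; rewrite mcoeff0; apply/eqP; rewrite mcoeff_eq0.
  by apply/negP => /pN.
have dp i : mderiv i p = 0.
  apply: IH => [m /mderiv_supp/pN|]; first by rewrite mdegD mdeg1 addn1.
  move=> x xb; have := is_derive_pfun i p x (x 0 i); rewrite set_coord_id => -[_ <-].
  rewrite (@near_eq_derive _ _ _ _ (cst 0)) ?derive_cst //.
  near=> t; apply: p0 => j; rewrite set_coordE; case: (eqVneq j i) => [->|//].
  have : t \in `]a 0 i, b 0 i[ by near: t; apply: near_in_itvoo; rewrite in_itv /=; exact: xb.
  by rewrite in_itv.
have nz m : m != mnm0 -> mcoeff m p = 0.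
  move=> m0; have [i mi] : exists i, m i != 0%N.
    apply/existsP; apply: contraNT m0; rewrite negb_exists => /forallP H.
    by apply/eqP/mnmP => i; rewrite mnm0E; apply/eqP; have := H i; rewrite negbK.
  exact: mderiv_eq0 (dp i) mi.
have pC : p = mpolyC n (mcoeff mnm0 p).
  apply/mpolyP => m; rewrite mcoeffC; case: eqVneq => [->|/nz ->]; first by rewrite mulr1.
  by rewrite mulr0.
have := p0 (\row_i ((a 0 i + b 0 i) / 2)); rewrite pC /pfun mevalC => ->.
  by rewrite mpolyC0.
by move=> i; rewrite mxE; have := ab i; lra.
Unshelve. all: by end_near. Qed.

End PolynomialFunctions.

(** * Degrees of freedom and Stokes' theorem *)

Section DegreesOfFreedom.
Local Close Scope classical_set_scope.
Local Open Scope set_scope.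
Variables (R : realType) (n : nat) (a b : 'rV[R]_n).
Hypothesis ab : forall i, a 0 i < b 0 i.
Notation I := (iter_integral a b).
Implicit Types (i j : 'I_n) (s t F e : {set 'I_n}) (m : multinom n).
Implicit Types (p q : mpoly n R) (x : 'rV[R]_n) (v u : pform R n).
Implicit Types (f g : 'rV[R]_n -> R).
Implicit Types (w : {set 'I_n} -> 'rV[R]_n -> R).

Definition dof_fun F w v x : R :=
  \sum_(t : {set 'I_n} | t \subset F) sgn R t (F :\: t) * (w t x * pfun (v (F :\: t)) x).

Definition dof F e w v : R := I (enum F) (dof_fun F w v) (vertex a b e).

Lemma face_integral_dof F e (w : fform R n) v :
  face_integral a b F e (wedge (trace F w) (eval_form v)) = dof F e w v.
Proof.
rewrite /face_integral /dof; congr iter_integral; apply/funext => x.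
rewrite ffunE fct_sumE /=; apply: eq_bigr => t tF.
by rewrite fct_signE ffunE tF eval_formE.
Qed.

Lemma bcont_dof_fun F w v : (forall t, bcont a b (w t)) -> bcont a b (dof_fun F w v).
Proof.
move=> cw x xB; apply: continuous_for_sum => t; apply: continuous_for_mul.
  exact: cst_continuous.
by apply: continuous_for_mul; [exact: cw | exact: pfun_continuous].
Qed.

Lemma dof_linl F e (c d : R) w1 w2 v : (forall t, bcont a b (w1 t)) ->
  (forall t, bcont a b (w2 t)) ->
  dof F e (fun t x => c * w1 t x + d * w2 t x) v = c * dof F e w1 v + d * dof F e w2 v.
Proof.
move=> c1 c2; rewrite /dof -box_integral_lin //; [|exact: vertex_box|exact: bcont_dof_fun..].
congr iter_integral; apply/funext => x; rewrite /dof_fun !big_distrr -big_split /=.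
by apply: eq_bigr => t _; ring.
Qed.

Lemma dof_sumr (J : Type) (r : seq J) (c : J -> R) (V : J -> pform R n) F e w v :
  (forall t, bcont a b (w t)) ->
  (forall t, t \subset F -> v t = \sum_(j <- r) c j *: V j t) ->
  dof F e w v = \sum_(j <- r) c j * dof F e w (V j).
Proof.
move=> cw vE; rewrite /dof -box_integral_sum //; [|exact: vertex_box|by move=> j; exact: bcont_dof_fun].
congr iter_integral; apply/funext => x; rewrite /dof_fun.
under [RHS]eq_bigr do rewrite big_distrr; rewrite exchange_big; apply: eq_bigr => t tF.
rewrite vE ?subsetDl // /pfun raddf_sum !big_distrr /=; apply: eq_bigr => j _.
by rewrite mevalZ; ring.
Qed.

Lemma dof_suml (J : Type) (r : seq J) (c : J -> R) (W : J -> {set 'I_n} -> 'rV[R]_n -> R)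
    F e v : (forall y t, bcont a b (W y t)) ->
  dof F e (fun t x => \sum_(j <- r) c j * W j t x) v = \sum_(j <- r) c j * dof F e (W j) v.
Proof.
move=> cw; rewrite /dof -box_integral_sum //; [|exact: vertex_box|by move=> j; exact: bcont_dof_fun].
congr iter_integral; apply/funext => x; rewrite /dof_fun.
under [RHS]eq_bigr do rewrite big_distrr; rewrite exchange_big; apply: eq_bigr => t tF.
rewrite big_distrl big_distrr /=; apply: eq_bigr => j _.
by ring.
Qed.

Lemma dof0r F e w v : (forall t, t \subset F -> v t = 0) -> dof F e w v = 0.
Proof.
move=> v0; rewrite /dof -[RHS](iter_integral0 a b (enum F) (vertex a b e)).
congr iter_integral; apply/funext => x; rewrite /dof_fun big1 // => t tF.
by rewrite v0 ?subsetDl // /pfun meval0 !mulr0.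
Qed.

Lemma vertexE e i : vertex a b e 0 i = if i \in e then b 0 i else a 0 i.
Proof. by rewrite mxE. Qed.

Lemma set_coord_vertexU e i : set_coord (vertex a b e) i (b 0 i) = vertex a b (i |: e).
Proof.
apply/rowP => j; rewrite set_coordE !vertexE !inE; case: (eqVneq j i) => [->|] //.
Qed.

Lemma set_coord_vertexD e i : set_coord (vertex a b e) i (a 0 i) = vertex a b (e :\ i).
Proof.
by apply/rowP => j; rewrite set_coordE !vertexE !inE; case: (eqVneq j i) => [->|].
Qed.

Lemma enum_split F i : i \in F -> exists l1 l2,
  [/\ enum F = l1 ++ i :: l2, enum (F :\ i) = l1 ++ l2, i \notin l1 & i \notin l2].
Proof.
move=> iF; have iE : i \in enum F by rewrite mem_enum.
have [l1 [l2 E]] : exists l1 l2, enum F = l1 ++ i :: l2.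
  by case/splitPr: iE => l1 l2; exists l1, l2.
have := enum_uniq F; rewrite E cat_uniq /= negb_or => /and3P[_ /andP[il1 _] /andP[il2 _]].
exists l1, l2; split=> //.
have -> : enum (F :\ i) = [seq j <- enum F | j != i].
  rewrite {1}/enum_mem -filter_predI; apply: eq_filter => j /=.
  by rewrite -[LHS]/(j \in F :\ i) !inE.
rewrite E filter_cat /= eqxx /=; congr (_ ++ _).
  by apply/all_filterP/allP => j jl /=; apply: contraNneq il1 => <-.
by apply/all_filterP/allP => j jl /=; apply: contraNneq il2 => <-.
Qed.

Lemma pfun_msubst i c p x : x 0 i = c -> pfun (msubst i c p) x = pfun p x.
Proof. by move=> xi; rewrite /pfun meval_msubst -xi set_coord_id. Qed.

Lemma facet_eq F i x f g : (forall y : 'rV[R]_n, y 0 i = x 0 i -> f y = g y) ->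
  I (enum (F :\ i)) f x = I (enum (F :\ i)) g x.
Proof.
move=> fg; apply: eq_iter_integral => y /(_ i)[/fg//|[]].
by rewrite mem_enum !inE eqxx.
Qed.

(** The boundary terms of Stokes' theorem contain [v], which may involve x_i and so need not be a
    test form of the facet; its trace is one and gives the same integral. *)
Lemma dof_ptrace F i e w v c : vertex a b e 0 i = c ->
  dof (F :\ i) e w (ptrace i c v) = dof (F :\ i) e w v.
Proof.
move=> ec; apply: facet_eq => y; rewrite ec => yi; apply: eq_bigr => t tF.
by rewrite ffunE !inE eqxx andbF pfun_msubst.
Qed.

Lemma face_partial F i e f g : i \in F -> bcont a b f -> bcont a b g ->
  is_bpartial a b i f g ->
  I (enum F) g (vertex a b e) =
  I (enum (F :\ i)) f (vertex a b (i |: e)) - I (enum (F :\ i)) f (vertex a b (e :\ i)).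
Proof.
move=> iF cf cg fg; have [l1 [l2 [-> -> il1 il2]]] := enum_split iF.
rewrite (box_integral_partial ab il1 il2 _ cf cg fg); last exact: vertex_box.
by rewrite set_coord_vertexU set_coord_vertexD.
Qed.

Lemma is_bpartialM i f g p : is_bpartial a b i f g ->
  is_bpartial a b i (fun x => f x * pfun p x)
    (fun x => g x * pfun p x + f x * pfun (mderiv i p) x).
Proof.
move=> fg x xB xi; have := fg x xB xi => H1.
have := is_derive_pfun i p x (x 0 i); rewrite set_coord_id => H2.
have := is_deriveM (f := fun z : R => f (set_coord x i z)) (g := fun z : R => pfun p (set_coord x i z)) H1 H2.
rewrite /= set_coord_id => H; apply: is_derive_eq H _.
rewrite -[_ *: _]/(_ * _) -[X in _ + X]/(_ * _); ring.
Qed.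

Lemma box_integral_sumP (J : Type) (r : seq J) (P : pred J) l (c : J -> R)
    (G : J -> 'rV[R]_n -> R) x : box a b x -> (forall y, bcont a b (G y)) ->
  I l (fun z => \sum_(j <- r | P j) c j * G j z) x =
  \sum_(j <- r | P j) c j * I l (G j) x.
Proof.
move=> xB cG; rewrite -[RHS]big_filter -(box_integral_sum ab) //.
by congr iter_integral; apply/funext => z; rewrite big_filter.
Qed.

Lemma sum_subset_mem (G : {set 'I_n} -> 'I_n -> R) F :
  \sum_(t : {set 'I_n} | t \subset F) \sum_(i in t) G t i =
  \sum_(i in F) \sum_(s : {set 'I_n} | s \subset F :\ i) G (i |: s) i.
Proof.
rewrite (exchange_big_dep (mem F)) /=; last first.
  by move=> t i tF it; exact: fintype.subsetP tF _ it.
apply: eq_bigr => i iF; rewrite (reindex_onto (fun s => i |: s) (fun t => t :\ i)) /=.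
  apply: eq_bigl => s; rewrite !inE eqxx /= finset.subUset finset.sub1set iF /= subsetD1.
  rewrite -andbA; congr (_ && _); case: (boolP (i \in s)) => is_.
    apply/negbTE/negP => /andP[_ /eqP E]; move: is_; rewrite -E.
    by rewrite !inE eqxx.
  by rewrite setU1K // eqxx.
by move=> t /andP[_ it]; rewrite finset.setD1K.
Qed.

Lemma sum_subset_compl (G : {set 'I_n} -> 'I_n -> R) F :
  \sum_(s : {set 'I_n} | s \subset F) \sum_(i in F :\: s) G s i =
  \sum_(i in F) \sum_(s : {set 'I_n} | s \subset F :\ i) G s i.
Proof.
rewrite (exchange_big_dep (mem F)) /=; last by move=> s i _; rewrite inE => /andP[].
apply: eq_bigr => i iF; apply: eq_bigl => s.
by rewrite subsetD1 inE; congr (_ && _); rewrite -[i \in mem F]/(i \in F) iF andbT.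
Qed.

(** The regularity that Stokes' theorem asks for, shared by smooth forms and evaluated polynomial
    forms. *)
Definition C1 w : Prop := forall s, bcont a b (w s) /\ forall i,
  bcont a b (partial i (w s)) /\ is_bpartial a b i (w s) (partial i (w s)).

(** This is the Leibniz rule d (w /\ v) = d w /\ v + (-1) ^+ k w /\ d v, read on the coefficient of
    dx_F; the sum over i in F is that of d (w /\ v). *)
Lemma stokes_fun k F (w : fform R n) v x : is_kform k w ->
  dof_fun F (fform_d w) v x =
  \sum_(i in F) sgn R [set i] (F :\ i) * (\sum_(s : {set 'I_n} | s \subset F :\ i)
     sgn R s (F :\ i :\: s) *
     (partial i (w s) x * pfun (v (F :\ i :\: s)) x + w s x * pfun (mderiv i (v (F :\ i :\: s))) x))
  - (-1) ^+ k * dof_fun F w (pform_d v) x.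
Proof.
move=> kw; apply/eqP; rewrite -subr_eq0 opprB addrA subr_eq0 addrC; apply/eqP.
have -> : dof_fun F (fform_d w) v x = \sum_(t : {set 'I_n} | t \subset F) \sum_(i in t)
    sgn R t (F :\: t) * (sgn R [set i] (t :\ i) * (partial i (w (t :\ i)) x * pfun (v (F :\: t)) x)).
  apply: eq_bigr => t tF; rewrite ffunE fct_sumE mulr_suml big_distrr /=.
  by apply: eq_bigr => i _; rewrite fct_signE /sgn; ring.
have -> : dof_fun F w (pform_d v) x = \sum_(s : {set 'I_n} | s \subset F) \sum_(i in F :\: s)
    sgn R s (F :\: s) * (sgn R [set i] (F :\: s :\ i) * (w s x * pfun (mderiv i (v (F :\: s :\ i))) x)).
  apply: eq_bigr => t tF; rewrite ffunE /pfun raddf_sum !big_distrr /=.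
  apply: eq_bigr => i _; rewrite /sgn -!(signr_odd _ (inversions [set i] _)).
  by case: odd; rewrite ?expr0 ?expr1 ?mul1r // !mulN1r mevalN; ring.
rewrite sum_subset_mem sum_subset_compl big_distrr -big_split /=.
apply: eq_bigr => i iF; rewrite !big_distrr -big_split /=.
apply: eq_bigr => s; rewrite subsetD1 => /andP[sF is_].
set F2 := F :\ i :\: s.
have E1 : F :\: (i |: s) = F2 by rewrite /F2 -finset.setDDl.
have E2 : F :\: s :\ i = F2 by rewrite /F2 !finset.setDDl finset.setUC.
have iF2 : i \notin F2 by rewrite !inE eqxx andbF.
have E3 : F :\: s = i |: F2.
  by rewrite -E2 finset.setD1K // !inE is_.
have E4 : F :\ i = s :|: F2.
  apply/setP => z; rewrite !inE; case: (boolP (z \in s)) => zs //=.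
  by rewrite (fintype.subsetP sF _ zs) andbT; apply: contraNneq is_ => <-.
have dsF : [disjoint s & F2].
  by rewrite -setI_eq0; apply/eqP/setP => z; rewrite !inE; case: (z \in s).
rewrite E1 E2 E3 [in sgn R [set i] (F :\ i)]E4 setU1K //.
rewrite (sgnUl R F2 (s := [set i])) ?disjoints1 // (sgnUr R [set i] dsF).
rewrite (sgnUr R s (t := [set i])) ?disjoints1 //.
have [sk|sk] := eqVneq #|s| k; last first.
  have -> : w s x = 0 by rewrite (kw s) //; exact/eqP.
  by rewrite !(mul0r, mulr0, addr0); ring.
(* The sign (-1) ^+ k comes from moving dx_i across dx_s, where #|s| = k. *)
have := sgn1C R is_; have := sgn_sqr R s [set i]; rewrite sk.
set A := sgn R s [set i]; set B := sgn R [set i] s => H1 <-.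
ring: H1.
Qed.

(** Integrating the i-th term of [stokes_fun] along x_i leaves the facets x_i = b i and x_i = a i,
    which [i |: e] and [e :\ i] encode. *)
Lemma stokes k F e (w : fform R n) v : C1 w -> is_kform k w ->
  dof F e (fform_d w) v =
  \sum_(i in F) sgn R [set i] (F :\ i) *
    (dof (F :\ i) (i |: e) w v - dof (F :\ i) (e :\ i) w v)
  - (-1) ^+ k * dof F e w (pform_d v).
Proof.
move=> cw kw.
have cw0 t : bcont a b (w t) by case: (cw t).
pose P i s x : R := partial i (w s) x * pfun (v (F :\ i :\: s)) x
  + w s x * pfun (mderiv i (v (F :\ i :\: s))) x.
have cP i s : bcont a b (P i s).
  apply: bcontD; apply: bcontM; rewrite //; try exact: bcont_pfun.
  by have [_ /(_ i)[]] := cw s.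
pose Q i x : R := \sum_(s : {set 'I_n} | s \subset F :\ i) sgn R s (F :\ i :\: s) * P i s x.
have cQ i : bcont a b (Q i).
  move=> x xB; apply: continuous_for_sum => s; apply: continuous_for_mul.
    exact: cst_continuous.
  exact: cP.
have -> : dof F e (fform_d w) v = I (enum F) (fun x =>
    1 * (\sum_(i in F) sgn R [set i] (F :\ i) * Q i x) + (- (-1) ^+ k) * dof_fun F w (pform_d v) x) (vertex a b e).
  congr iter_integral; apply/funext => x; rewrite (stokes_fun _ _ _ kw) mul1r mulNr.
  by [].
rewrite box_integral_lin //; [|exact: vertex_box| |exact: bcont_dof_fun]; last first.
  move=> x xB; apply: continuous_for_sum => i; apply: continuous_for_mul.
    exact: cst_continuous.
  exact: cQ.
rewrite mul1r mulNr; congr (_ - _); rewrite box_integral_sumP //; last exact: vertex_box.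
apply: eq_bigr => i iF; congr (_ * _); rewrite box_integral_sumP //; last exact: vertex_box.
rewrite /dof /dof_fun !box_integral_sumP //; try exact: vertex_box; 
  try by move=> s; apply: bcontM => //; exact: bcont_pfun.
rewrite -sumrB; apply: eq_bigr => s sF; rewrite -mulrBr; congr (_ * _).
apply: face_partial => //; first by apply: bcontM => //; exact: bcont_pfun.
by apply: is_bpartialM; have [_ /(_ i)[]] := cw s.
Qed.

Lemma C1_pfun u : C1 (eval_form u).
Proof.
move=> s; rewrite eval_formE; split=> [|i]; first exact: bcont_pfun.
rewrite partial_pfun; split; first exact: bcont_pfun.
exact: is_bpartial_pfun.
Qed.

Lemma C1_smooth k (w : fform R n) : smooth_kform a b k w -> C1 w.
Proof.
move=> [_ [U [oU bU sw]]] s; split.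
  by move=> x /bU xU; have [+ _] := sw s [::] x xU.
move=> i; split; first by move=> x /bU xU; have [+ _] := sw s [:: i] x xU.
move=> x /bU xU _; apply/is_derive_delta; apply: DeriveDef => //.
by have [_] := sw s [::] x xU; exact.
Qed.

End DegreesOfFreedom.

(** * Unisolvence *)

Section Unisolvence.
Local Close Scope classical_set_scope.
Local Open Scope set_scope.
Variables (R : realType) (n : nat) (a b : 'rV[R]_n).
Hypothesis ab : forall i, a 0 i < b 0 i.
Notation I := (iter_integral a b).
Implicit Types (i j : 'I_n) (s F e : {set 'I_n}) (m : multinom n) (l : seq 'I_n).
Implicit Types (p q g h : mpoly n R) (x : 'rV[R]_n) (v u : pform R n).

Definition mders l p := foldr (@mderiv n R) p l.

Lemma setD_subK (F s : {set 'I_n}) : s \subset F -> F :\: (F :\: s) = s.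
Proof. by move=> sF; rewrite finset.setDDr finset.setDv finset.set0U; apply/finset.setIidPr. Qed.

Lemma mders_mderiv l i p : mders l (mderiv i p) = mderiv i (mders l p).
Proof. by elim: l => //= j l ->; rewrite mderiv_comm. Qed.

Lemma mders_supp l p m : m \in msupp (mders l p) ->
  exists2 m', m' \in msupp p & (mdeg m' = mdeg m + size l)%N /\ forall i, (m i <= m' i)%N.
Proof.
elim: l m => [|i l IH] m /=; first by move=> mp; exists m; rewrite ?addn0.
move=> /mderiv_supp/IH[m' m'p [dm' le]]; exists m' => //.
rewrite mdegD mdeg1 in dm'; split; first by rewrite dm'; lia.
by move=> j; apply: leq_trans (le j); rewrite mnmDE leq_addr.
Qed.

Lemma mderiv_msubst i j c p : i != j ->
  mderiv j (msubst i c p) = msubst i c (mderiv j p).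
Proof.
move=> ij; rewrite [in RHS]mderivE msubst_sum msubstE linear_sum.
apply: eq_bigr => m _ /=.
have -> : msubst i c ((m j)%:R *: mpolyX R (mnm_sub m (mnm1 j))) =
    (m j)%:R *: msubst i c (mpolyX R (mnm_sub m (mnm1 j))) by exact: linearZ.
rewrite !linearZ /= msubstX mderivX mclearE eq_sym (negPf ij).
rewrite mnmBE mnm1E eq_sym (negPf ij) subn0 !scalerA.
congr (_ *: mpolyX _ _); first by ring.
apply/mnmP => k; rewrite !(mnmBE, mnm1E, mclearE).
by case: eqVneq => // ->; rewrite eq_sym (negPf ij).
Qed.

(** A polynomial killed by d_i does not contain x_i, so it equals its value at x_i = a i. The
    derivatives are peeled off one at a time, since this substitution commutes with those in the
    other variables. *)
Lemma mders_eq0 l p : uniq l -> mders l p = 0 ->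
  (forall i, i \in l -> msubst i (a 0 i) p = 0) -> p = 0.
Proof.
elim: l p => //= i l IH p /andP[il ul] dp Hp; apply: IH => //; last first.
  by move=> j jl; apply: Hp; rewrite inE jl orbT.
have si0 : msubst i (a 0 i) (mders l p) = 0.
  have := Hp i (mem_head _ _).
  elim: l il {ul dp Hp} => //= j l IH; rewrite inE negb_or => /andP[ij il] s0.
  by rewrite -mderiv_msubst // IH // raddf0.
apply/mpolyP => m; rewrite mcoeff0.
have [mi|mi] := eqVneq (m i) 0%N; last exact: mderiv_eq0 dp mi.
have : mcoeff m (msubst i (a 0 i) (mders l p)) = 0 by rewrite si0 mcoeff0.
rewrite (@mcoeff_msubst _ _ _ _ _ _ (msize (mders l p)).+1); last first.
  move=> m' /msize_mdeg_lt /ltnW; apply: leq_trans.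
  by rewrite mdegE (bigD1 i) //= leq_addr.
rewrite mi eqxx big_ord_recl big1 => [|j _].
  by rewrite expr0 mul1r addr0 => <-; congr mcoeff; apply/mnmP => j;
    rewrite mnmDE mulmnE muln0 addn0.
by rewrite (mderiv_eq0 dp) ?mulr0 // mnmDE mulmnE mnm1E eqxx mul1n lift0 addnS.
Qed.

Lemma integral_by_parts F e i g h : i \in F ->
  msubst i (a 0 i) g = 0 -> msubst i (b 0 i) g = 0 ->
  I (enum F) (pfun (g * mderiv i h)) (vertex a b e) =
  - I (enum F) (pfun (mderiv i g * h)) (vertex a b e).
Proof.
move=> iF ga gb; apply/eqP; rewrite -subr_eq0 opprK.
have -> : I (enum F) (pfun (g * mderiv i h)) (vertex a b e) +
    I (enum F) (pfun (mderiv i g * h)) (vertex a b e) =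
    I (enum F) (pfun (mderiv i (g * h))) (vertex a b e).
  have := box_integral_lin ab (enum F) 1 1 (vertex_box ab e) (bcont_pfun (p := g * mderiv i h))
    (bcont_pfun (p := mderiv i g * h)).
  rewrite !mul1r => <-; congr iter_integral; apply/funext => x.
  by rewrite !mul1r mderivM /pfun mevalD addrC.
rewrite (face_partial ab e iF (@bcont_pfun _ _ a b _) (@bcont_pfun _ _ a b _) (@is_bpartial_pfun _ _ a b i (g * h))).
have Z e' c : vertex a b e' 0 i = c -> msubst i c g = 0 ->
    I (enum (F :\ i)) (pfun (g * h)) (vertex a b e') = 0.
  move=> ec gc; rewrite -[RHS](iter_integral0 a b (enum (F :\ i)) (vertex a b e')).
  apply: facet_eq => y; rewrite ec => yi.
  by rewrite pfunM -(pfun_msubst g yi) gc /pfun meval0 mul0r.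
rewrite (Z _ _ _ gb) ?(Z _ _ _ ga) ?subr0 //.
  by rewrite vertexE !inE eqxx.
by rewrite vertexE !inE eqxx.
Qed.

Lemma integral_by_parts_iter F e l g h : uniq l -> {subset l <= F} ->
  (forall i, i \in l -> msubst i (a 0 i) g = 0 /\ msubst i (b 0 i) g = 0) ->
  I (enum F) (pfun (g * mders l h)) (vertex a b e) =
  (-1) ^+ size l * I (enum F) (pfun (mders l g * h)) (vertex a b e).
Proof.
elim: l g => [|i l IH] g /=; first by rewrite expr0 mul1r.
move=> /andP[il ul] lF Hg; have [ga gb] := Hg i (mem_head _ _).
rewrite integral_by_parts ?lF ?mem_head // IH //; last 2 first.
- by move=> j jl; apply: lF; rewrite inE jl orbT.
- move=> j jl; have ji : j != i by apply: contraNneq il => <-.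
  have [|Ha Hb] := Hg j; first by rewrite inE jl orbT.
  by rewrite -!mderiv_msubst // Ha Hb !raddf0.
by rewrite mders_mderiv exprS -mulrA mulN1r.
Qed.

Lemma sqr_integral_eq0 F e g : (forall m i, m \in msupp g -> i \notin F -> m i = 0%N) ->
  I (enum F) (pfun (g * g)) (vertex a b e) = 0 -> g = 0.
Proof.
move=> gF I0; apply: (pfun_zero ab) => x xab.
(* [g] does not contain the coordinates outside F, so the point may be moved onto the face. *)
pose y : 'rV[R]_n := \row_i if i \in F then x 0 i else vertex a b e 0 i.
have -> : pfun g x = pfun g y.
  rewrite !pfunE big_seq [RHS]big_seq; apply: eq_bigr => m mg; congr (_ * _).
  apply: eq_bigr => i _; rewrite mxE; case: ifPn => // iF.
  by rewrite (gF m i) // !expr0.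
apply: (@box_integral_sqr_eq0 R n a b ab (enum F) (pfun g) (vertex a b e)).
- exact: vertex_box.
- exact: bcont_pfun.
- by rewrite -[RHS]I0; congr iter_integral; apply/funext => z; rewrite pfunM.
- by move=> i; rewrite mem_enum mxE; case: (i \in F).
Qed.

Definition vanishing_dofs r k F u : Prop := forall F' e v, F' \subset F ->
  (k <= #|F'| <= r./2 + k)%N -> PFaceForm F' (r - 2 * (#|F'| - k)) (#|F'| - k) v ->
  dof a b F' e (eval_form u) v = 0.

(** A degree of freedom of the trace on F' is one of [u] itself, on the parallel face that lies in
    x_i = c; the test form does not contain x_i. *)
Lemma vanishing_dofs_ptrace r k F i c u : c = a 0 i \/ c = b 0 i ->
  vanishing_dofs r k F u -> vanishing_dofs r k (F :\ i) (ptrace i c u).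
Proof.
move=> ci Hu F' e v; rewrite subsetD1 => /andP[F'F iF'] kF' vF'.
have [e' ve'] : exists e', vertex a b e' = set_coord (vertex a b e) i c.
  by case: ci => ->; [rewrite set_coord_vertexD | rewrite set_coord_vertexU];
     eexists; reflexivity.
rewrite -[RHS](Hu F' e' v F'F kF' vF') /dof ve'.
rewrite -(iter_integral_set_coord _ _ _ _ (i := i)) ?mem_enum //.
congr iter_integral; apply/funext => x; apply: eq_bigr => t tF.
rewrite !eval_formE !ffunE ifF; last by apply: contraNF iF' => /(fintype.subsetP tF).
congr (_ * (_ * _)); first by rewrite /pfun meval_msubst.
case: vF' => _ _ vF'; rewrite !pfunE big_seq [RHS]big_seq; apply: eq_bigr => m mg.
congr (_ * _); apply: eq_bigr => j _; rewrite set_coordE; case: (eqVneq j i) => // ->.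
by rewrite (vF' _ _ mg i iF') !expr0.
Qed.

(* Testing the coefficient [u s] with [prod_(i in F :\: s) d_i ^ 2 (u s)] gives,
   after integration by parts, the square of [prod_(i in F :\: s) d_i (u s)]. *)
Lemma dof_unisolvent r k F u : SwForm r k u -> on_face F u ->
  vanishing_dofs r k F u -> u = 0.
Proof.
have [N] := ubnP #|F|; elim: N F u => // N IH F u FN Su Fu Du.
have tr0 i c : i \in F -> c = a 0 i \/ c = b 0 i -> ptrace i c u = 0.
  move=> iF ci; apply: (IH (F :\ i)).
  - by move: FN; rewrite (cardsD1 i F) iF.
  - exact: SwForm_ptrace.
  - exact: on_face_ptrace.
  - exact: vanishing_dofs_ptrace.
have deg : forall s m, m \in msupp (u s) -> (mdeg m <= r)%N.
  apply: (SwForm_deg (a := a 0) (b := b 0) _ Su Fu).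
    by move=> i; rewrite lt_eqF.
  by move=> i iF; split; apply: tr0 => //; [left|right].
apply/ffunP => s; rewrite [RHS]ffunE.
have [sF|sF] := boolP (s \subset F); last first.
  apply/mpolyP => m; rewrite mcoeff0; apply/eqP; rewrite mcoeff_eq0; apply/negP.
  by move=> /Fu[sF' _]; rewrite sF' in sF.
have [sk|/eqP sk] := eqVneq #|s| k; last by case: Su => ku _; exact: ku.
pose l := enum (F :\: s); pose D := mders l (mders l (u s)).
have sl : size l = (#|F| - k)%N by rewrite /l -cardE cardsD (finset.setIidPr sF) sk.
have lF : {subset l <= F} by move=> i; rewrite mem_enum inE => /andP[].
have ul : uniq l := enum_uniq _.
have su i : i \in l -> msubst i (a 0 i) (u s) = 0 /\ msubst i (b 0 i) (u s) = 0.
  rewrite mem_enum inE => /andP[is_ iF].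
  have Z c : ptrace i c u = 0 -> msubst i c (u s) = 0.
    by move=> /ffunP/(_ s); rewrite !ffunE (negPf is_).
  by split; apply: Z; apply: tr0 => //; [left|right].
have Dsupp m : m \in msupp D -> exists2 m', m' \in msupp (u s) &
    (mdeg m' = mdeg m + 2 * (#|F| - k))%N /\ forall i, (m i <= m' i)%N.
  move=> /mders_supp[m1 /mders_supp[m2 m2u [d2 le2]] [d1 le1]]; exists m2 => //.
  split; first by rewrite d2 d1 sl; lia.
  by move=> i; exact: leq_trans (le1 i) (le2 i).
have I0 : I (enum F) (pfun (u s * D)) (vertex a b finset.set0) = 0.
  have [dF|dF] := leqP #|F| (r./2 + k); last first.
    (* Such a face carries no degree of freedom, but 2 (#|F| - k) exceeds r and hence the degree of
       [u s]. *)
    have -> : D = 0.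
      apply/mpolyP => m; rewrite mcoeff0; apply/eqP; rewrite mcoeff_eq0; apply/negP.
      move=> /Dsupp[m' /deg m'r [d _]]; move: dF m'r d; lia.
    rewrite mulr0 -[RHS](iter_integral0 a b (enum F) (vertex a b finset.set0)).
    by congr iter_integral; apply/funext => x; rewrite /pfun meval0.
  (* By [deg], D has degree at most r - 2 (#|F| - k), the bound for test forms on F. The sign
     cancels that of dx_s /\ dx_(F :\: s). *)
  pose v : pform R n := [ffun t => if t == F :\: s then sgn R s (F :\: s) *: D else 0].
  rewrite -[RHS](Du F finset.set0 v) //; last 2 first.
  - by rewrite dF andbT -sk subset_leq_card.
  - split; first split.
    + move=> t tk; rewrite ffunE; case: eqP => // tE; case: tk.
      by rewrite tE -sl cardE.
    + move=> m t; rewrite /form_monomial ffunE; case: eqP => [_|]; last by rewrite msupp0.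
      move=> /msuppZ_le/Dsupp[m' /deg]; lia.
    + move=> t tF; rewrite ffunE; case: eqP => // tE; case/negP: tF.
      by rewrite tE subsetDl.
    + move=> m t; rewrite /form_monomial ffunE; case: eqP => [_|]; last by rewrite msupp0.
      move=> /msuppZ_le/Dsupp[m' /Fu[_ Fm'] [_ le]] i /Fm' m'i.
      by apply/eqP; rewrite -leqn0 -m'i.
  congr iter_integral; apply/funext => x; rewrite /dof_fun (bigD1 s) //= big1.
    rewrite addr0 eval_formE ffunE eqxx pfunM /pfun mevalZ.
    by ring: (sgn_sqr R s (F :\: s)).
  move=> t /andP[tF ts]; have -> : v (F :\: t) = 0; last by rewrite /pfun meval0 !mulr0.
  rewrite ffunE ifF //; apply: contraNF ts => /eqP E; by rewrite -(setD_subK tF) E setD_subK.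
have := @integral_by_parts_iter F finset.set0 l (u s) (mders l (u s)) ul lF su.
rewrite -/D I0 => /esym/eqP; rewrite mulf_eq0 signr_eq0 /= => /eqP sq0.
apply: (mders_eq0 ul) => [|i /su[]//].
apply: sqr_integral_eq0 sq0 => m i /mders_supp[m' /Fu[_ Fm'] [_ le]] /Fm' m'i.
by apply/eqP; rewrite -leqn0 -m'i.
Qed.

End Unisolvence.

Lemma square_system (R : fieldType) (J : finType) (M : J -> J -> R) (y : J -> R) :
  (forall c : J -> R, (forall i, \sum_j c j * M i j = 0) -> forall j, c j = 0) ->
  exists c : J -> R, forall i, \sum_j c j * M i j = y i.
Proof.
move=> inj; pose A := \matrix_(j < #|J|, i < #|J|) M (enum_val i) (enum_val j).
have AE (c : 'rV[R]_#|J|) i : (c *m A) 0 i = \sum_j c 0 (enum_rank j) * M (enum_val i) j.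
  rewrite mxE (reindex _ (onW_bij _ (@enum_rank_bij J))) /=; apply: eq_bigr => j _.
  by rewrite mxE enum_rankK.
have uA : A \in unitmx.
  rewrite -row_free_unit; apply: inj_row_free => v vA.
  apply/rowP => i; rewrite mxE -(enum_valK i).
  apply: (inj (fun j => v 0 (enum_rank j))) => j.
  by have := AE v (enum_rank j); rewrite vA mxE enum_rankK => <-.
exists (fun j => ((\row_i y (enum_val i)) *m invmx A) 0 (enum_rank j)) => i.
by have := AE ((\row_i y (enum_val i)) *m invmx A) (enum_rank i);
  rewrite mulmxKV // mxE enum_rankK => <-.
Qed.

(** * Linear structure of S_r Lambda^k and construction of shape functions *)

Section ShapeFunctions.
Local Close Scope classical_set_scope.
Local Open Scope set_scope.
Variables (R : realType) (n : nat).
Implicit Types (i j : 'I_n) (s t F e : {set 'I_n}) (m w : multinom n).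
Implicit Types (p q : mpoly n R) (v u h : pform R n).

Definition fscale (c : R) u : pform R n := [ffun t => c *: u t].

Lemma koszulD h1 h2 : koszul (h1 + h2) = koszul h1 + koszul h2 :> pform R n.
Proof.
apply/ffunP => s; rewrite !ffunE -big_split; apply: eq_bigr => i _ /=.
by rewrite !ffunE mulrDr mulrDr.
Qed.

Lemma koszulZ c h : koszul (fscale c h) = fscale c (koszul h).
Proof.
apply/ffunP => s; rewrite !ffunE scaler_sumr; apply: eq_bigr => i _ /=.
by rewrite !ffunE -!scalerAr.
Qed.

Lemma koszul0 : koszul (0 : pform R n) = 0.
Proof. by apply/ffunP => s; rewrite !ffunE big1 // => i _; rewrite ffunE !mulr0. Qed.

Lemma pform_dD h1 h2 : pform_d (h1 + h2) = pform_d h1 + pform_d h2 :> pform R n.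
Proof.
apply/ffunP => s; rewrite !ffunE -big_split; apply: eq_bigr => i _ /=.
by rewrite !ffunE mderivD mulrDr.
Qed.

Lemma pform_dZ c h : pform_d (fscale c h) = fscale c (pform_d h).
Proof.
apply/ffunP => s; rewrite !ffunE scaler_sumr; apply: eq_bigr => i _ /=.
by rewrite !ffunE mderivZ -!scalerAr.
Qed.

Lemma pform_d0 : pform_d (0 : pform R n) = 0.
Proof. by apply/ffunP => s; rewrite !ffunE big1 // => i _; rewrite ffunE raddf0 mulr0. Qed.

Lemma fscale_sum c N (H : nat -> pform R n) :
  fscale c (\sum_(l < N) H l) = \sum_(l < N) fscale c (H l).
Proof.
apply: (big_morph (fscale c)).
  by move=> x y; apply/ffunP => s; rewrite !ffunE scalerDr.
by apply/ffunP => s; rewrite !ffunE scaler0.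
Qed.

Lemma form_monomialD u1 u2 m s : form_monomial (u1 + u2) m s ->
  form_monomial u1 m s \/ form_monomial u2 m s.
Proof.
rewrite /form_monomial !mcoeff_msupp ffunE mcoeffD => H; apply/orP; apply: contraNT H.
by rewrite negb_or !negbK => /andP[/eqP -> /eqP ->]; rewrite addr0.
Qed.

Lemma form_monomialZ c u m s : form_monomial (fscale c u) m s -> form_monomial u m s.
Proof. by rewrite /form_monomial ffunE; exact: msuppZ_le. Qed.

Lemma form_monomial0 m s : ~ form_monomial (0 : pform R n) m s.
Proof. by rewrite /form_monomial ffunE msupp0. Qed.

Lemma is_kformZ k c u : is_kform k u -> is_kform k (fscale c u).
Proof. by move=> ku s /ku E; rewrite ffunE E scaler0. Qed.

Lemma is_kform0 k : is_kform k (0 : pform R n).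
Proof. by move=> s _; rewrite ffunE. Qed.

Lemma HlForm_lin r l k c u1 u2 : HlForm r l k u1 -> HlForm r l k u2 ->
  HlForm r l k (u1 + fscale c u2).
Proof.
move=> [[k1 h1] l1] [[k2 h2] l2]; split; first split.
- by apply: is_kformD => //; exact: is_kformZ.
- by move=> m s /form_monomialD[/h1|/form_monomialZ/h2].
- by move=> m s /form_monomialD[/l1|/form_monomialZ/l2].
Qed.

Lemma HlForm0 r l k : HlForm r l k (0 : pform R n).
Proof.
split; first split; first exact: is_kform0.
  by move=> m s /form_monomial0.
by move=> m s /form_monomial0.
Qed.

Lemma JForm0 r k : JForm r k (0 : pform R n).
Proof. by exists 0%N, (fun=> 0); split=> //; rewrite big_ord0. Qed.

Lemma JForm_lin r k c u1 u2 : JForm r k u1 -> JForm r k u2 ->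
  JForm r k (u1 + fscale c u2).
Proof.
move=> [N1 [h1 [H1 ->]]] [N2 [h2 [H2 ->]]].
(* A family is unconstrained beyond its length, so it is cut off by 0 before two families of
   different lengths are added. *)
pose g N (h : nat -> pform R n) l := if (l < N)%N then h l else 0.
have Hg N (h : nat -> pform R n) l :
    (forall l, (l < N)%N -> HlForm (r + l) l.+1 k.+1 (h l)) ->
    HlForm (r + l) l.+1 k.+1 (g N h l).
  by rewrite /g; case: ifP => [lN /(_ _ lN)//|_ _]; exact: HlForm0.
exists (N1 + N2)%N, (fun l => g N1 h1 l + fscale c (g N2 h2 l)); split.
  by move=> l _; apply: HlForm_lin; exact: Hg.
have gE N N' (h : nat -> pform R n) : (N <= N')%N ->
    \sum_(l < N) koszul (h l) = \sum_(l < N') koszul (g N h l).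
  move=> NN; rewrite (big_ord_widen _ (fun l => koszul (h l)) NN) big_mkcond.
  by apply: eq_bigr => l _; rewrite /g; case: ifP => // _; rewrite koszul0.
rewrite (gE _ _ h1 (leq_addr N2 N1)) (gE _ _ h2 (leq_addl N1 N2)).
rewrite (fscale_sum c _ (fun l => koszul (g N2 h2 l))) -big_split.
by apply: eq_bigr => l _; rewrite koszulD koszulZ.
Qed.

Lemma JForm_pred0 r k : JForm_pred r k (0 : pform R n).
Proof. by case: k => // k; exact: JForm0. Qed.

Lemma JForm_pred_lin r k c u1 u2 : JForm_pred r k u1 -> JForm_pred r k u2 ->
  JForm_pred r k (u1 + fscale c u2).
Proof.
case: k => [-> ->|k]; last exact: JForm_lin.
by apply/ffunP => s; rewrite !ffunE scaler0 addr0.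
Qed.

Lemma PForm_lin r k c u1 u2 : PForm r k u1 -> PForm r k u2 -> PForm r k (u1 + fscale c u2).
Proof.
move=> [k1 h1] [k2 h2]; split; first by apply: is_kformD => //; exact: is_kformZ.
by move=> m s /form_monomialD[/h1|/form_monomialZ/h2].
Qed.

Lemma PForm0 r k : PForm r k (0 : pform R n).
Proof. by split; [exact: is_kform0 | move=> m s /form_monomial0]. Qed.

Lemma SForm0 r k : SForm r k (0 : pform R n).
Proof.
exists 0, 0, 0; split; [exact: PForm0|exact: JForm0|exact: JForm_pred0|].
by rewrite pform_d0 !addr0.
Qed.

Lemma SForm_lin r k c u1 u2 : SForm r k u1 -> SForm r k u2 -> SForm r k (u1 + fscale c u2).
Proof.
move=> [p1 [j1 [g1 [Hp1 Hj1 Hg1 ->]]]] [p2 [j2 [g2 [Hp2 Hj2 Hg2 ->]]]].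
exists (p1 + fscale c p2), (j1 + fscale c j2), (g1 + fscale c g2); split.
- exact: PForm_lin.
- exact: JForm_lin.
- exact: JForm_pred_lin.
- rewrite pform_dD pform_dZ; apply/ffunP => s; rewrite !ffunE !scalerDr.
  by rewrite (addrACA (p1 s + j1 s)) (addrACA (p1 s)).
Qed.

Lemma SForm_sum r k (J : Type) (q : seq J) (c : J -> R) (P : J -> pform R n) :
  (forall x, SForm r k (P x)) ->
  SForm r k [ffun t : {set 'I_n} => \sum_(x <- q) c x *: P x t].
Proof.
move=> HP; elim: q => [|x q IH].
  rewrite (_ : [ffun _ => _] = 0); first exact: SForm0.
  by apply/ffunP => t; rewrite !ffunE big_nil.
rewrite (_ : [ffun _ => _] = [ffun t : {set 'I_n} => \sum_(x <- q) c x *: P x t] + fscale (c x) (P x)).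
  exact: SForm_lin.
by apply/ffunP => t; rewrite !ffunE big_cons addrC.
Qed.

Lemma JForm_koszul r l k h : HlForm (r + l) l.+1 k.+1 h -> JForm r k (koszul h).
Proof.
move=> Hh; exists l.+1, (fun l' => if l' == l then h else 0); split.
  by move=> l' _; case: eqP => [->//|_]; exact: HlForm0.
rewrite (bigD1 ord_max) //= eqxx big1 ?addr0 // => l' /negPf.
by rewrite -val_eqE /= => ->; rewrite koszul0.
Qed.

(* [x_i] is exchanged for [dx_i] in [x^m dx_s], which preserves the weight. *)
Definition exm i m s : pform R n := [ffun t =>
  if (i \notin s) && (t == i |: s) then sgn R [set i] s *: mpolyX R (mnm_sub m (mnm1 i)) else 0].

Lemma weight_ex i m s : i \notin s -> m i != 0%N ->
  weight (mnm_sub m (mnm1 i)) (i |: s) = weight m s.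
Proof.
move=> is_ mi; apply/mnmP => j; rewrite !weightE mnmBE mnm1E !inE eq_sym.
by case: eqVneq => [->|_] /=; [rewrite (negPf is_); lia|rewrite subn0].
Qed.

Lemma wcomp_exm i m s w : weight m s i != 0%N ->
  wcomp w (exm i m s) =1 ext_i i (wcomp w (mono R m s)).
Proof.
move=> wi t; rewrite /ext_i wcomp_mono.
have [is_|is_] := boolP (i \in s).
  rewrite /wcomp ffunE is_ /= mcoeff0 if_same; case: ifP => // it.
  by case: eqP => [E|]; rewrite /= ?mulr0 //; move: is_; rewrite -E !inE eqxx.
have mi : m i != 0%N by move: wi; rewrite weightE (negPf is_) addn0.
have -> : wcomp w (exm i m s) t = sgn R [set i] s * wcomp w (mono R (mnm_sub m (mnm1 i)) (i |: s)) t.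
  rewrite /wcomp !ffunE is_ /=; case: ifP => _; last by rewrite mulr0.
  by case: eqP => _; rewrite ?mcoeffZ // mcoeff0 mulr0.
rewrite wcomp_mono weight_ex //; case: ifP => it.
  have -> : (t :\ i == s) = (t == i |: s).
    by apply/eqP/eqP => [<-|->]; [rewrite finset.setD1K | rewrite setU1K].
  by case: eqP => [->|_]; rewrite ?setU1K //= !mulr0.
by case: eqP => [E|_]; rewrite /= ?mulr0 //; move: it; rewrite E !inE eqxx.
Qed.

Variable i0 : 'I_n.

(** An index of weight above 1 is preferred, since wedging with its dx_i uses up no linear index.
    The choice depends on the weight only, which makes the homotopy linear on each weight. The value
    [i0] is a mere default. *)
Definition pivot w : 'I_n := if [pick i | (1 < w i)%N] is Some i then i
  else odflt i0 [pick i | w i != 0%N].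

Lemma pivotP w : (0 < mdeg w)%N -> w (pivot w) != 0%N /\
  ((1 < w (pivot w))%N \/ forall i, (w i <= 1)%N).
Proof.
move=> w0; rewrite /pivot; case: pickP => [i wi|w1]; first by split; [lia|left].
split; last by right=> i; rewrite leqNgt w1.
case: pickP => //= Z; move: w0; rewrite mdegE big1 // => i _.
by have := Z i; case: eqP.
Qed.

(* For a monomial of weight w above degree [r] this is [K (E u) + D (K u)], E being
   the contracting homotopy [ext_i (pivot w)] of [K]; it determines u, as [K] maps
   it to [|w| K u] and [K (E u) = u - E (K u)]. *)
Definition shape_fun r m s : pform R n := if (mdeg m <= r)%N then mono R m s
  else koszul (exm (pivot (weight m s)) m s) + pform_d (koszul (mono R m s)).

Lemma is_kform_mono m s : is_kform #|s| (mono R m s).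
Proof. by move=> t ts; rewrite ffunE; case: eqP => // E; case: ts; rewrite E. Qed.

Lemma form_monomial_mono m s m' t : form_monomial (mono R m s) m' t -> m' = m /\ t = s.
Proof.
rewrite /form_monomial ffunE; case: eqP => [->|_]; last by rewrite msupp0.
by rewrite msuppX inE => /eqP.
Qed.

(** Write mdeg m = r + 1 + l. By hypothesis the monomial has linear degree at least l + 1, as the
    l-th piece of J_(r+1) requires. After the exchange of x_i for dx_i the degree is r + l, and J_r
    requires linear degree l + 1 again: the pivot is chosen for this. *)
Lemma shape_SForm r k m s : (0 < r)%N -> #|s| = k -> (mdeg m <= r + ldeg m s)%N ->
  SForm r k (shape_fun r m s).
Proof.
move=> r0 sk ms; rewrite /shape_fun; case: leqP => [mr|rm].
  exists (mono R m s), 0, 0; split; [|exact: JForm0|exact: JForm_pred0|].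
    by split; [rewrite -sk; exact: is_kform_mono | move=> m' t /form_monomial_mono[-> _]].
  by rewrite pform_d0 !addr0.
have [l ml] : exists l, mdeg m = (r.+1 + l)%N by exists (mdeg m - r.+1)%N; lia.
exists 0, (koszul (exm (pivot (weight m s)) m s)), (koszul (mono R m s)); split.
- exact: PForm0.
- apply: (JForm_koszul (l := l)).
  have := @pivotP (weight m s); rewrite mdeg_weight ml addSn => /(_ isT).
  set i := pivot _ => -[wi pi].
  have supp m' t : form_monomial (exm i m s) m' t -> [/\ i \notin s, t = i |: s & m' = mnm_sub m (mnm1 i)].
    rewrite /form_monomial ffunE; case: ifP => [/andP[is_ /eqP ->]|_]; last by rewrite msupp0.
    by move=> /msuppZ_le; rewrite msuppX inE => /eqP.
  split; first split.
  + move=> t tk; rewrite ffunE; case: ifP => // /andP[is_ /eqP tE].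
    by case: tk; rewrite tE cardsU1 is_ sk.
  + move=> m' t /supp[is_ _ ->].
    have mi : m i != 0%N by move: wi; rewrite weightE (negPf is_) addn0.
    have : (mnm_add (mnm_sub m (mnm1 i)) (mnm1 i)) = m.
      by apply/mnmP => j; rewrite mnmDE mnmBE mnm1E; case: eqVneq => [<-|_]; lia.
    by move=> /(congr1 (@mdeg n)); rewrite mdegD mdeg1 ml; lia.
  + move=> m' t /supp[is_ -> ->].
    have mi : m i != 0%N by move: wi; rewrite weightE (negPf is_) addn0.
    rewrite ldeg_weight weight_ex //; move: pi; rewrite weightE (negPf is_) addn0 => -[pi|pi].
      have -> : wlin (weight m s) :\: (i |: s) = wlin (weight m s) :\: s.
        apply/setP => j; rewrite !inE; case: eqVneq => [->|//].
        by rewrite weightE (negPf is_) addn0 /=; case: eqP => //; lia.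
      by rewrite -ldeg_weight; lia.
    (* No weight exceeds 1, so all the variables in x^m are linear and lie outside s. Losing one of
       them leaves at least mdeg m - 1 = r + l, which is at least l + 1 because r > 0. *)
    have mld : (mdeg m <= #|wlin (weight m s) :\: s|)%N.
      rewrite mdegE -sum1_card [leqRHS]big_mkcond /=; apply: leq_sum => j _.
      by rewrite !inE weightE; have := pi j; rewrite weightE; case: (j \in s); case: (m j) => [|[|]].
    have : (#|wlin (weight m s) :\: s| <= 1 + #|wlin (weight m s) :\: (i |: s)|)%N.
      rewrite -(cards1 i); apply: leq_trans (leq_card_setU _ _); apply: subset_leq_card.
      by apply/fintype.subsetP => j; rewrite !inE; case: (j == i).
    by move: mld; lia.
- case: k sk => [|k] sk.
    apply/ffunP => t; rewrite !ffunE big1 // => i _; rewrite ffunE ifF ?mulr0 //.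
    apply/eqP => E; have := cards0 'I_n; move/eqP: sk; rewrite cards_eq0 => /eqP sk.
    by move: (setU11 i t); rewrite E sk inE.
  apply: (JForm_koszul (l := l)); split; first split.
  + by rewrite -sk; exact: is_kform_mono.
  + by move=> m' t /form_monomial_mono[-> _].
  + by move=> m' t /form_monomial_mono[-> ->]; lia.
- by rewrite add0r.
Qed.

End ShapeFunctions.

(** * Solvability of the system of degrees of freedom *)

Section Existence.
Local Close Scope classical_set_scope.
Local Open Scope set_scope.
Variables (R : realType) (n : nat) (a b : 'rV[R]_n).
Hypothesis ab : forall i, a 0 i < b 0 i.
Variables (i0 : 'I_n) (r k : nat).
Hypothesis r_gt0 : (0 < r)%N.
Implicit Types (i : 'I_n) (s t F e : {set 'I_n}) (m : multinom n) (v u : pform R n).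
Notation I := (iter_integral a b).

Definition superlinear_le m s : bool := (#|s| == k) && (mdeg m <= r + ldeg m s)%N.

(** The degree bound makes the type finite and excludes no monomial, as the linear degree is at most
    [n]. *)
Definition sindex : finType := {x : {set 'I_n} * bmultinom n (r + n).+1 | superlinear_le (bmnm x.2) x.1}.

Definition imono (j : sindex) : multinom n := bmnm (val j).2.
Definition iset (j : sindex) : {set 'I_n} := (val j).1.
Definition ishape (j : sindex) : pform R n := shape_fun R i0 r (imono j) (iset j).

(* The degree of freedom attached to a monomial [x^m dx_s]: outside s, the variables
   of exponent 0 and 1 are fixed at [a i] and [b i], the other ones are free and
   their exponent is lowered by 2 in the test form. *)
Definition iface (j : sindex) : {set 'I_n} := iset j :|: [set i | (1 < imono j i)%N].
Definition ivertex (j : sindex) : {set 'I_n} := [set i | (i \notin iset j) && (imono j i == 1%N)].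
Definition itest (j : sindex) : pform R n :=
  mono R (Multinom [tuple if i \in iset j then imono j i else (imono j i - 2)%N | i < n]) (iface j :\: iset j).

Lemma ldeg_le_card m s (A : {set 'I_n}) : (forall i, i \in A -> (i \notin s) && (m i == 1%N)) ->
  (#|A| <= ldeg m s)%N.
Proof.
move=> HA; rewrite ldeg_weight; apply: subset_leq_card; apply/fintype.subsetP => i /HA.
by rewrite !inE weightE => /andP[is_]; rewrite is_ (negPf is_) addn0.
Qed.

Lemma ldeg_le_n m s : (ldeg m s <= n)%N.
Proof. by rewrite ldeg_weight -[leqRHS]card_ord max_card. Qed.

(** Every monomial degree of freedom is attached to some index, so equations indexed by [sindex]
    control all of them. Only [e :\: F] matters, as the free coordinates of the vertex are
    integrated over. *)
Lemma ex_sindex F e t m : t \subset F -> #|t| = (#|F| - k)%N -> (k <= #|F| <= r./2 + k)%N ->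
  (mdeg m <= r - 2 * (#|F| - k))%N -> (forall i, i \notin F -> m i = 0%N) ->
  exists j : sindex, [/\ iface j = F, ivertex j = e :\: F & itest j = mono R m t].
Proof.
move=> tF tk /andP[kF Fr] mr mF.
(* Inverse of [itest] and [ivertex]: exponents go up by 2 on t, and become 1 at the fixed
   coordinates placed at [b i]. *)
pose M : multinom n := Multinom [tuple (m i + 2 * (i \in t) + (i \in e :\: F))%N | i < n].
have ME i : M i = (m i + 2 * (i \in t) + (i \in e :\: F))%N by rewrite mnmE.
pose s := F :\: t.
have sk : #|s| = k by rewrite cardsD (finset.setIidPr tF) tk; lia.
have Mdeg : mdeg M = (mdeg m + 2 * (#|F| - k) + #|e :\: F|)%N.
  rewrite -tk mdegE (eq_bigr (fun i => m i + 2 * (i \in t) + (i \in e :\: F))%N) // !big_split /=.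
  have S (A : {set 'I_n}) : (\sum_i (i \in A))%N = #|A|.
    by rewrite -sum1_card [RHS]big_mkcond; apply: eq_bigr => i _; case: (i \in A).
  congr (_ + _ + _)%N; [by rewrite mdegE | by rewrite big1_eq S addn0 addnn mul2n | exact: S].
have eF i : i \in e :\: F -> (i \notin s) && (M i == 1%N).
  rewrite ME => ie; rewrite ie; move: ie; rewrite !inE => /andP[iF ie].
  rewrite (negPf iF) andbF /= mF // add0n; apply/eqP.
  by have /negPf -> : i \notin t by apply: contra iF; exact: fintype.subsetP tF i.
have le_e := ldeg_le_card eF.
have Mr : (mdeg M <= r + ldeg M s)%N by move: Fr; rewrite Mdeg; lia.
have Mb : (mdeg M < (r + n).+1)%N by rewrite ltnS; apply: leq_trans Mr _; rewrite leq_add2l ldeg_le_n.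
have gd : superlinear_le (bmnm (BMultinom Mb)) s by rewrite /superlinear_le sk eqxx.
pose j : sindex := Sub (s, BMultinom Mb) gd.
have js : iset j = s by rewrite /iset SubK.
have jM : imono j = M by rewrite /imono SubK.
exists j; have jF : iface j = F.
  rewrite /iface js jM; apply/setP => i; rewrite !inE ME.
  have [iF|iF] := boolP (i \in F); rewrite /= ?andbT ?andbF /=.
    by case: (i \in t) => //=; lia.
  have /negPf -> : i \notin t by apply: contra iF; exact: fintype.subsetP tF i.
  by rewrite mF // !inE iF /=; case: (i \in e).
split=> //.
  rewrite /ivertex js jM; apply/setP => i; rewrite inE.
  apply/idP/idP => [|/eF //]; rewrite ME !inE negb_and negbK.
  have [it|it] := boolP (i \in t); first by move=> /andP[_]; case: eqP => //; lia.
  move=> /= /andP[iF]; rewrite mF // (negPf iF) /= muln0 !add0n /=.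
  by case: (i \in e).
rewrite /itest jF js jM /s setD_subK //; congr mono; apply/mnmP => i.
rewrite mnmE ME !inE; have [it|it] := boolP (i \in t).
  by rewrite /= (fintype.subsetP tF i it) /=; lia.
have [iF|iF] := boolP (i \in F) => /=; first by rewrite !addn0.
by rewrite mF //; case: (i \in e).
Qed.

Lemma iter_integral_agree (l : seq 'I_n) f (x y : 'rV[R]_n) :
  (forall i, i \notin l -> x 0 i = y 0 i) -> I l f x = I l f y.
Proof.
elim: l x y => [|i l IH] x y xy /=.
  by congr f; apply/rowP => i; exact: xy.
apply: eq_Rintegral => t _; apply: IH => j jl; rewrite !set_coordE.
by case: eqVneq => // ji; apply: xy; rewrite inE negb_or ji.
Qed.

Lemma dof_vertexD F e w v : dof a b F e w v = dof a b F (e :\: F) w v.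
Proof.
apply: iter_integral_agree => i; rewrite mem_enum => iF.
by rewrite !vertexE inE iF.
Qed.

Lemma dof_span (w1 w2 : {set 'I_n} -> 'rV[R]_n -> R) :
  (forall t, bcont a b (w1 t)) -> (forall t, bcont a b (w2 t)) ->
  (forall j, dof a b (iface j) (ivertex j) w1 (itest j) =
             dof a b (iface j) (ivertex j) w2 (itest j)) ->
  forall F e v, (k <= #|F| <= r./2 + k)%N ->
  PFaceForm F (r - 2 * (#|F| - k)) (#|F| - k) v -> dof a b F e w1 v = dof a b F e w2 v.
Proof.
move=> c1 c2 H F e v kF [[kv rv] Fv mv]; rewrite !(dof_vertexD F e).
pose q := [seq (t, m) | t <- enum {set 'I_n}, m <- msupp (v t)].
have vE t : v t = \sum_(x <- q) mcoeff x.2 (v x.1) *: mono R x.2 x.1 t.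
  rewrite big_allpairs_dep (bigD1_seq t) ?mem_enum ?enum_uniq //= [X in _ + X]big1.
    rewrite addr0 {1}[v t]mpolyE; apply: eq_bigr => m _.
    by rewrite ffunE eqxx.
  move=> t' tt; rewrite big1 // => m _; rewrite ffunE eq_sym (negPf tt) scaler0 //.
have dofE w : (forall t, bcont a b (w t)) -> dof a b F (e :\: F) w v =
    \sum_(x <- q) mcoeff x.2 (v x.1) * dof a b F (e :\: F) w (mono R x.2 x.1).
  by move=> cw; apply: (dof_sumr ab).
rewrite !dofE //.
rewrite big_seq [RHS]big_seq; apply: eq_bigr => -[t m] /allpairsPdep[t' [m' [_ m'v [-> ->]]]] /=.
congr (_ * _).
have tF : t' \subset F by apply: contraT => /Fv E; move: m'v; rewrite E msupp0.
have tk : #|t'| = (#|F| - k)%N by apply: contrapT => /kv E; move: m'v; rewrite E msupp0.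
have [j [<- <- <-]] := @ex_sindex F e t' m' tF tk kF (rv _ _ m'v) (mv _ _ m'v).
exact: H.
Qed.

Lemma wcomp_shape_low m s (w : multinom n) : #|s| = k -> (mdeg w <= r + k)%N ->
  wcomp w (shape_fun R i0 r m s) =1 wcomp w (mono R m s).
Proof.
move=> sk wr t; rewrite /shape_fun; case: leqP => // rm.
have wE : w == weight m s = false.
  by apply/eqP => E; move: wr; rewrite E mdeg_weight sk; lia.
have E : wcomp w (mono R m s) =1 fun=> 0 by move=> u; rewrite wcomp_mono wE andbF.
rewrite E wcompD wcomp_koszul wcomp_d (eq_Dx _ (wcomp_koszul w _)).
rewrite (eq_Dx _ (eq_Kz E)) (eq_Dx _ (@Kz0 R n)) Dx0 addr0.
rewrite (eq_Kz (h := fun=> 0)) ?Kz0 // => u; rewrite wcomp_exm.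
  by rewrite /ext_i E mulr0 if_same.
by have := @pivotP _ i0 (weight m s); rewrite mdeg_weight => -[//|]; lia.
Qed.

(** The pivot is taken at [w], whatever the monomial; when [w] is not the weight of the monomial
    both sides vanish. Hence one linear map serves all shape functions in weight [w]. *)
Lemma wcomp_shape_high m s (w : multinom n) : #|s| = k -> (r + k < mdeg w)%N ->
  wcomp w (shape_fun R i0 r m s) =1 fun t =>
    Kz (ext_i (pivot i0 w) (wcomp w (mono R m s))) t + Dx w (Kz (wcomp w (mono R m s))) t.
Proof.
move=> sk wr t; rewrite /shape_fun; case: leqP => [mr|rm].
  have wE : w == weight m s = false.
    by apply/eqP => E; move: wr; rewrite E mdeg_weight sk; lia.
  have E : wcomp w (mono R m s) =1 fun=> 0 by move=> u; rewrite wcomp_mono wE andbF.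
  rewrite E (eq_Dx _ (eq_Kz E)) (eq_Dx _ (@Kz0 R n)) Dx0 addr0.
  rewrite (eq_Kz (h := fun=> 0)) ?Kz0 // => u.
  by rewrite /ext_i E mulr0 if_same.
rewrite wcompD wcomp_koszul wcomp_d (eq_Dx _ (wcomp_koszul w _)); congr (_ + _).
apply: eq_Kz => u; rewrite wcomp_exm.
  have [->//|wE] := eqVneq w (weight m s).
  by rewrite /ext_i !wcomp_mono (negPf wE) !andbF !mulr0 !if_same.
by have := @pivotP _ i0 (weight m s); rewrite mdeg_weight => -[//|]; lia.
Qed.

Lemma iset_card j : #|iset j| = k.
Proof. by have /andP[/eqP] := valP j. Qed.

Definition lincomb (c : sindex -> R) : pform R n :=
  [ffun t : {set 'I_n} => \sum_j c j *: ishape j t].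

Lemma wcomp_lincomb w c s : wcomp w (lincomb c) s = \sum_j c j * wcomp w (ishape j) s.
Proof.
rewrite /wcomp ffunE; case: ifP => _; last by rewrite big1 // => j _; rewrite mulr0.
by rewrite raddf_sum; apply: eq_bigr => j _; rewrite /= mcoeffZ.
Qed.

Lemma lincomb_inj c : lincomb c = 0 -> forall j, c j = 0.
Proof.
move=> c0; pose C (w : multinom n) s := \sum_j c j * wcomp w (mono R (imono j) (iset j)) s.
have C0 w s : C w s = 0.
  have H t := wcomp_lincomb w c t; rewrite c0 in H.
  have [wr|wr] := leqP (mdeg w) (r + k).
    rewrite -(wcomp0 R w s) H; apply: eq_bigr => j _.
    by rewrite wcomp_shape_low // iset_card.
  pose i := pivot i0 w.
  have E t : Kz (ext_i i (C w)) t + Dx w (Kz (C w)) t = 0.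
    rewrite -(wcomp0 R w t) H.
    have -> : ext_i i (C w) = fun u : {set 'I_n} => \sum_j c j * ext_i i (wcomp w (mono R (imono j) (iset j))) u.
      by apply/funext => u; rewrite -ext_i_sum.
    rewrite (eq_Dx _ (@Kz_sum _ _ _ c (fun j => wcomp w (mono R (imono j) (iset j))))).
    rewrite Kz_sum Dx_sum -big_split; apply: eq_bigr => j _ /=.
    by rewrite (wcomp_shape_high _ _ wr) ?iset_card // mulrDr.
  have KC t : Kz (C w) t = 0.
    have := eq_Kz E t; rewrite Kz0 KzD KzKz add0r KzDx (eq_Dx _ (KzKz _)) Dx0 subr0.
    move/eqP; rewrite mulf_eq0 pnatr_eq0 -/(wdeg w) wdeg_mdeg => /orP[/eqP w0|/eqP //].
    by move: wr; rewrite w0.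
  have := E s; rewrite Kz_ext_i (eq_Dx _ KC) Dx0 addr0.
  by rewrite /ext_i KC mulr0 if_same subr0.
(* A monomial is determined by its weight and its set, so this evaluation isolates [c j]. *)
move=> j; have := C0 (weight (imono j) (iset j)) (iset j); rewrite /C (bigD1 j) //= big1.
  by rewrite wcomp_mono !eqxx mulr1 addr0.
move=> j' jj; rewrite wcomp_mono; case: eqP => [s'|_]; last by rewrite mulr0.
case: eqP => [w'|_]; rewrite /= ?mulr0 //.
case/eqP: jj; apply/val_inj; rewrite [val j']surjective_pairing [val j]surjective_pairing.
congr (_, _); first by rewrite -/(iset j) -/(iset j') s'.
apply/val_inj => /=; have := congr1 (fun w => mnm_sub w (mesym1 (iset j))) w'.
by rewrite weightK s' weightK => /esym.
Qed.

Lemma pfun_lincomb c t x : pfun (lincomb c t) x = \sum_j c j * pfun (ishape j t) x.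
Proof.
by rewrite ffunE /pfun raddf_sum; apply: eq_bigr => j _; rewrite /= mevalZ.
Qed.

Lemma lincomb_SForm c : SForm r k (lincomb c).
Proof.
apply: SForm_sum => j; apply: shape_SForm => //; first exact: iset_card.
by have /andP[] := valP j.
Qed.

Lemma bcont_eval u t : bcont a b (eval_form u t).
Proof. by rewrite eval_formE; exact: bcont_pfun. Qed.

Lemma dof_lincomb c F e v :
  dof a b F e (eval_form (lincomb c)) v = \sum_j c j * dof a b F e (eval_form (ishape j)) v.
Proof.
rewrite -(dof_suml ab); last by move=> j t; exact: bcont_eval.
congr iter_integral; apply/funext => x; apply: eq_bigr => t _.
rewrite eval_formE pfun_lincomb; congr (_ * (_ * _)); apply: eq_bigr => j _.
by rewrite eval_formE.
Qed.

(** If a combination of shape functions is killed by the indexed degrees of freedom, [dof_span],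
    used against the zero form, shows that all of them vanish; then [dof_unisolvent] and
    [lincomb_inj] make its coefficients 0. *)
Lemma dof_exists (w : {set 'I_n} -> 'rV[R]_n -> R) : (forall t, bcont a b (w t)) ->
  exists2 p, SForm r k p & forall F e v, (k <= #|F| <= r./2 + k)%N ->
    PFaceForm F (r - 2 * (#|F| - k)) (#|F| - k) v ->
    dof a b F e (eval_form p) v = dof a b F e w v.
Proof.
move=> cw.
pose M x y := dof a b (iface x) (ivertex x) (eval_form (ishape y)) (itest x).
have M_inj (c : sindex -> R) : (forall x, \sum_y c y * M x y = 0) -> forall y, c y = 0.
  move=> Hc; apply: lincomb_inj.
  apply: (@dof_unisolvent R n a b ab r k [set: 'I_n]).
  - exact/SForm_Sw/lincomb_SForm.
  - by move=> s m _; split=> [|i]; rewrite ?finset.subsetT ?inE.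
  - move=> F e v _ kF Hv.
    have Z F' e' v' : dof a b F' e' (fun=> cst 0) v' = 0.
      rewrite /dof -[RHS](iter_integral0 a b (enum F') (vertex a b e')).
      congr iter_integral; apply/funext => x; rewrite /dof_fun big1 // => t _.
      by rewrite mul0r mulr0.
    rewrite -[RHS](Z F e v); apply: dof_span => //.
    + by move=> t; exact: bcont_eval.
    + by move=> t x xB; exact: cst_continuous.
    + by move=> j; rewrite Z dof_lincomb Hc.
have [c Hc] := square_system (fun x => dof a b (iface x) (ivertex x) w (itest x)) M_inj.
exists (lincomb c); first exact: lincomb_SForm.
apply: dof_span => [t|//|j]; first exact: bcont_eval.
by rewrite dof_lincomb; exact: Hc.
Qed.

End Existence.

(** * The canonical projections *)

Section Projection.
Local Close Scope classical_set_scope.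
Local Open Scope set_scope.
Variables (R : realType) (n : nat) (a b : 'rV[R]_n).
Hypothesis ab : forall i, a 0 i < b 0 i.
Implicit Types (F e : {set 'I_n}) (p v : pform R n) (w : fform R n).

Lemma is_projectionP r k w p : is_projection r k a b w p <->
  SForm r k p /\ forall F e v, (k <= #|F| <= r./2 + k)%N ->
    PFaceForm F (r - 2 * (#|F| - k)) (#|F| - k) v ->
    dof a b F e (eval_form p) v = dof a b F e w v.
Proof.
have cF F : (#|F| <= n)%N by rewrite -[leqRHS]card_ord max_card.
split=> -[Sp H]; split=> // F e v kF Fv; have := H F e v; rewrite !face_integral_dof.
  by apply=> //; rewrite leq_min cF.
by apply=> //; move: kF; rewrite leq_min cF.
Qed.

Lemma projection_unique r k w p1 p2 :
  is_projection r k a b w p1 -> is_projection r k a b w p2 -> p1 = p2.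
Proof.
move=> /is_projectionP[S1 H1] /is_projectionP[S2 H2]; apply/eqP.
rewrite -subr_eq0; apply/eqP; apply: (dof_unisolvent ab (r := r) (k := k) (F := [set: 'I_n])).
- by apply: SwFormB; exact: SForm_Sw.
- by move=> s m _; split=> [|i]; rewrite ?finset.subsetT ?inE.
move=> F e v _ kF Fv.
have -> : dof a b F e (eval_form (p1 - p2)) v =
    dof a b F e (fun t x => 1 * eval_form p1 t x + (-1) * eval_form p2 t x) v.
  congr iter_integral; apply/funext => x; apply: eq_bigr => t _.
  by rewrite !eval_formE /pfun !ffunE mevalD mevalN mul1r mulN1r.
rewrite (dof_linl ab); try by move=> t; exact: bcont_eval.
by rewrite H1 // H2 // mul1r mulN1r subrr.
Qed.

Lemma projectionE r k w p : is_projection r k a b w p -> projection r k a b w = p.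
Proof.
move=> Hp; apply: (@projection_unique r k w) => //.
by rewrite /projection; case: xgetP => [x -> //|/(_ p)].
Qed.

Lemma projection_exists r k w : 'I_n -> (0 < r)%N -> (forall t, bcont a b (w t)) ->
  exists p, is_projection r k a b w p.
Proof.
move=> i0 r0 cw; have [p Sp Hp] := dof_exists ab i0 k r0 cw.
by exists p; apply/is_projectionP.
Qed.

Lemma PFaceForm_ptrace F i c s j v : PFaceForm F s j v ->
  PFaceForm (F :\ i) s j (ptrace i c v).
Proof.
move=> [[kv rv] Fv mv].
have ov : on_face F v.
  by move=> t m mt; split; [apply: contraT => /Fv E; move: mt; rewrite E msupp0 | exact: mv mt].
have ot : on_face (F :\ i) (ptrace i c v) by exact: on_face_ptrace.
split; first split.
- by move=> t tj; rewrite ffunE kv // [msubst _ _ _]raddf0 if_same.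
- move=> m t; rewrite /form_monomial ffunE; case: ifP => _; first by rewrite msupp0.
  move=> /msubst_supp[_ [d /rv]]; apply: leq_trans; rewrite mdegD; exact: leq_addr.
- move=> t tF; apply/mpolyP => m; rewrite mcoeff0; apply/eqP; rewrite mcoeff_eq0.
  by apply/negP => /ot[]; rewrite (negPf tF).
- by move=> m t /ot[].
Qed.

Lemma pform_d_supp v m t : form_monomial (pform_d v) m t ->
  exists i, i \in t /\ form_monomial v (mnm_add m (mnm1 i)) (t :\ i).
Proof.
rewrite /form_monomial mcoeff_msupp ffunE raddf_sum => H.
have /existsP[i /andP[it Hi]] : [exists i, (i \in t) && (mcoeff m
    ((-1) ^+ inversions [set i] (t :\ i) * mderiv i (v (t :\ i))) != 0)].
  apply: contraNT H; rewrite negb_exists => /forallP Z; rewrite big1 // => i it.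
  by have := Z i; rewrite it /= negbK => /eqP.
exists i; split=> //; apply: mderiv_supp; rewrite mcoeff_msupp.
by move: Hi; rewrite mcoeff_sign mulf_eq0 negb_or => /andP[].
Qed.

Lemma PFaceForm_le F s s' j v : (s <= s')%N -> PFaceForm F s j v -> PFaceForm F s' j v.
Proof.
move=> ss [[kv rv] Fv mv]; split=> //; split=> // m t /rv mr.
exact: leq_trans mr ss.
Qed.

Lemma PFaceForm_d F s j v : PFaceForm F s j v -> PFaceForm F s.-1 j.+1 (pform_d v).
Proof.
move=> [[kv rv] Fv mv].
have dF m t : form_monomial (pform_d v) m t ->
    [/\ (mdeg m < s)%N, t \subset F & forall i, i \notin F -> m i = 0%N].
  move=> /pform_d_supp[i [it H]]; have mF := mv _ _ H.
  have iF : i \in F.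
    by apply: contraT => /mF; rewrite mnmDE mnm1E eqxx addn1.
  split.
  - by have := rv _ _ H; rewrite mdegD mdeg1 addn1.
  - have tF : t :\ i \subset F.
      by apply: contraT => /Fv E; move: H; rewrite /form_monomial E msupp0.
    by rewrite -(finset.setD1K it) finset.subUset finset.sub1set iF.
  - by move=> x /mF; rewrite mnmDE; lia.
split; first split.
- exact: is_kform_d.
- by move=> m t /dF[]; lia.
- move=> t tF; apply/mpolyP => m; rewrite mcoeff0; apply/eqP; rewrite mcoeff_eq0.
  by apply/negP => /dF[_]; rewrite (negPf tF).
- by move=> m t /dF[].
Qed.

(** d lowers the degree of the polynomial part, turns J_r Lambda^k into the last summand of S_(r-1)
    Lambda^(k+1), and kills the summand that is already exact. *)
Lemma SForm_d r k p : (0 < r)%N -> SForm r k p -> SForm (r - 1) k.+1 (pform_d p).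
Proof.
move=> r0 [q [j [j' [[kq rq] Hj Hj' ->]]]].
exists (pform_d q), 0, j; split.
- split; first exact: is_kform_d.
  move=> m t /pform_d_supp[i [_ /rq]]; rewrite mdegD mdeg1; lia.
- exact: JForm0.
- by rewrite /JForm_pred subn1 prednK.
- by rewrite !pform_dD pform_dd !addr0.
Qed.

(** Let #|F| = q + k + 1, so that v has degree at most r - 1 - 2 q. Stokes' theorem uses the trace
    of v on facets, where the bound is r - 2 q, and d v on F, where it is r - 2 (q + 1): both are
    test forms for [w], except in the boundary case q = r./2. *)
Lemma projection_d r k w p : (0 < r)%N -> C1 a b w -> is_kform k w ->
  is_projection r k a b w p -> is_projection (r - 1) k.+1 a b (fform_d w) (pform_d p).
Proof.
move=> r0 cw kw /is_projectionP[Sp Hp]; apply/is_projectionP; split; first exact: SForm_d.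
move=> F e v /andP[kF Fr] [[kv rv] Fv mv]; rewrite -fform_d_eval.
have kp : is_kform k (eval_form p).
  move=> s sk; have [kp _] := SForm_Sw Sp.
  by apply/funext => x; rewrite eval_formE kp // /pfun meval0.
rewrite (stokes ab _ _ _ (@C1_pfun R n a b p) kp) (stokes ab _ _ _ cw kw).
have [q Fq] : exists q, #|F| = (q + k.+1)%N by exists (#|F| - k.+1)%N; rewrite subnK.
have Fk1 : (#|F| - k.+1 = q)%N by rewrite Fq addnK.
have Fk : (#|F| - k = q.+1)%N by rewrite Fq addnS -addSn addnK.
rewrite Fk1 in kv rv.
have q2 : (2 * q <= r - 1)%N.
  have : (q <= (r - 1)./2)%N by move: Fr; rewrite Fq leq_add2r.
  by rewrite -leq_double -mul2n => /leq_trans; apply; rewrite -[leqRHS]odd_double_half leq_addl.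
have qr : (q <= r./2)%N by rewrite -[q]doubleK half_leq // -mul2n; lia.
congr (_ - _ * _).
  apply: eq_bigr => i iF; congr (_ * _).
  have cFi : #|F :\ i| = (q + k)%N.
    by have := cardsD1 i F; rewrite iF Fq; lia.
  have E e' c : vertex a b e' 0 i = c ->
      dof a b (F :\ i) e' (eval_form p) v = dof a b (F :\ i) e' w v.
    move=> ec; rewrite -(dof_ptrace F (eval_form p) v ec) -(dof_ptrace F w v ec); apply: Hp.
      by rewrite cFi leq_addl leq_add2r.
    rewrite cFi addnK; apply: PFaceForm_ptrace.
    by apply: (PFaceForm_le (s := r - 1 - 2 * q)); first by lia.
  by rewrite !(E _ _ erefl).
have vd := PFaceForm_d (And3 (conj kv rv) Fv mv).
have [qlt|qge] := ltnP q r./2.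
  apply: Hp; first by rewrite (ltnW kF) Fq addnS -addSn leq_add2r.
  by rewrite Fk (_ : r - _ = (r - 1 - 2 * q).-1)%N //; lia.
(* Here q = r./2, and F has too large a dimension to carry a degree of freedom of [w]. But 2 q <= r
   - 1 forces r to be odd, so v has degree r - 1 - 2 q = 0. *)
have d0 : pform_d v = 0.
  apply/ffunP => t; rewrite [RHS]ffunE; apply/mpolyP => m; rewrite mcoeff0.
  apply/eqP; rewrite mcoeff_eq0; apply/negP => /pform_d_supp[i [_ /rv]].
  rewrite mdegD mdeg1.
  have := odd_double_half r; rewrite -mul2n; case: (odd r) => /=; lia.
by rewrite !dof0r // => t _; rewrite d0 ffunE.
Qed.

End Projection.

Theorem mainTheorem3 (R : realType) (n r : nat) (hn : (1 <= n)%N)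
    (hr : (n <= r)%N) (a b : 'rV[R]_n) (hT : forall i : 'I_n, a 0 i < b 0 i) :
  (forall (k : nat) (w : fform R n), (k < n)%N -> smooth_kform a b k w ->
     pform_d (projection (r - k) k a b w) =
     projection (r - k - 1) k.+1 a b (fform_d w)) /\
  (forall c : R,
     projection r 0 a b (const_form n (fun _ : 'rV[R]_n => c)) =
     const_form n (mpolyC n c)).
Proof.
have i0 : 'I_n by case: n hn {a b hT hr} => // m _; exact: ord0.
split=> [k w kn sw|c].
  have rk : (0 < r - k)%N by rewrite subn_gt0; exact: leq_trans kn hr.
  have cw := C1_smooth sw; have [kw _] := sw.
  have [p Hp] := projection_exists hT k i0 rk (fun t => proj1 (cw t)).
  (* The projection of d w may have index 0, a case outside [projection_exists]; [projection_d]
     itself exhibits it. *)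
  by rewrite (projectionE hT Hp) (projectionE hT (projection_d hT rk cw kw Hp)).
apply: projectionE => //; apply/is_projectionP; split.
  exists (const_form n (mpolyC n c)), 0, 0; split; [|exact: JForm0|by []|].
    split=> [s s0|m s]; rewrite /form_monomial ffunE; case: eqP => [sE|_] //.
      by case: s0; rewrite sE cards0.
    by rewrite mcoeff_msupp mcoeffC; case: (eqVneq m mnm0) => [->|_]; rewrite ?mdeg0 // mulr0 eqxx.
    by rewrite msupp0.
  by rewrite pform_d0 !addr0.
move=> F e v _ _; congr iter_integral; apply/funext => x; apply: eq_bigr => t _.
rewrite eval_formE !ffunE; case: eqP => _; rewrite /pfun ?mevalC ?meval0 //.
Qed.
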